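(* For any $\varepsilon>0$ there exists $d_0=d_0(\varepsilon)\ge1$ such that for any $d\ge d_0$ and any $0<\beta\le(1-\varepsilon)\beta_c(d)$ the following holds. Let $\mathbf G=\mathbf G(n,d/n)$ and let the influences $\{\Gamma_e\}$ be induced by the Edwards–Anderson model on $\mathbf G$ at inverse temperature $\beta$. Then for $\ell=r=\frac{\log n}{\sqrt d}$, $$\Pr\big[\text{every path in }\mathcal P_{r,\ell}(\mathbf G)\text{ contains a }(d,\varepsilon)\text{-block vertex}\big]\ge 1-n^{-d^{1/8}},$$ the probability being over $(\mathbf G,\{\Gamma_e\})$.
   Context: $\mathbf{G}(n,d/n)$: random graph on $n$ vertices, edges independent with probability $d/n$; Edwards–Anderson couplings $J_e$ i.i.d. standard Gaussians; $\beta_c(k)=\sqrt{2\pi}/k$. Influence $\Gamma_e=\frac{|1-\exp(\beta J_e)|}{1+\exp(\beta J_e)}$; $\mathcal A(u)=\sum_{w\sim u}\Gamma_{\{u,w\}}$; $M(u)=1-\varepsilon/4$ if $\mathcal A(u)\le1-\varepsilon/2$, else $d\,\mathcal A(u)$; for a path $P$ (distinct vertices, consecutive adjacent; length = number of edges) $M(P)=\prod_{v\in P}M(v)$. A $(d,\varepsilon)$-block vertex is a vertex $u$ such that every path of length at most $\log n$ starting at $u$ has $M(P)<1$. For a path $P$ and integer $r\ge0$, $N_r(P)$ is the set of vertices reachable from a vertex of $P$ by a path of length at most $r$; $P$ is $r$-locally simple if $N_r(P)$ induces a tree. $\mathcal P_{r,\ell}(G)$ is the set of $r$-locally simple paths of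 $G$ of length at least $\ell$. *)

(* Defs.v *)
From HB Require Import structures.
From mathcomp Require Import all_boot all_order all_algebra.
From mathcomp Require Import all_classical all_reals all_analysis.
Import Order.TTheory GRing.Theory Num.Theory.
Import numFieldNormedType.Exports.

Set Implicit Arguments.
Unset Strict Implicit.
Unset Printing Implicit Defensive.

Local Open Scope classical_set_scope.
Local Open Scope ring_scope.

Section Paths.
Variables (R : realType) (V : finType) (e : rel V).

(* A path is a head x and a tail p, with vertices x :: p and length size p. *)
Definition gpath (x : V) (p : seq V) : bool := path e x p && uniq (x :: p).

Definition induces_tree (S : set V) : Prop :=
  S !=set0 /\
  (forall x y, S x -> S y -> exists p : seq V,
      [/\ gpath x p, last x p = y & forall z, z \in x :: p -> S z]) /\
  (forall c : seq V, (2 < size c)%N -> (forall z, z \in c -> S z) ->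
      ~ ucycle e c).

(* The radius is real, so that (ln n) / sqrt d needs no explicit rounding;
   radius r and radius floor r give the same set. *)
Definition nbhd (r : R) (x : V) (p : seq V) : set V :=
  [set v | exists u q, [/\ u \in x :: p, gpath u q, last u q = v &
                           (size q)%:R <= r]].

Definition locally_simple (r : R) (x : V) (p : seq V) : Prop :=
  induces_tree (nbhd r x p).

Definition locally_simple_paths (r l : R) : set (V * seq V) :=
  [set xp | [/\ gpath xp.1 xp.2, locally_simple r xp.1 xp.2 &
                l <= (size xp.2)%:R]].

End Paths.

Section Influence.
Variables (R : realType) (V : finType) (e : rel V).
(* The edge joining u and w is the two-element set [set u; w]. *)
Variable Gam : {set V} -> R.
Variables (d eps : R).

Definition aggregate_influence (u : V) : R := \sum_(w | e u w) Gam [set u; w]%SET.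

Definition vweight (u : V) : R :=
  if aggregate_influence u <= 1 - eps / 2 then 1 - eps / 4
  else d * aggregate_influence u.

Definition pweight (x : V) (p : seq V) : R := \prod_(v <- x :: p) vweight v.

Definition block_vertex (u : V) : Prop :=
  forall p : seq V, gpath e u p -> (size p)%:R <= ln (#|V|%:R : R) ->
    pweight u p < 1.

End Influence.

Definition beta_c (R : realType) (k : R) : R := Num.sqrt (2 * pi) / k.

Definition influence (R : realType) (beta j : R) : R :=
  `|1 - expR (beta * j)| / (1 + expR (beta * j)).

Definition mutually_independent (disp : measure_display)
    (T : measurableType disp) (R : realType) (P : probability T R)
    (I : finType) (D : {set I}) (F : I -> set (set T)) : Prop :=
  forall (S : {set I}) (E : I -> set T), S \subset D ->
    (forall i, i \in S -> F i (E i)) ->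
    P (\bigcap_(i in [set` S]) E i) = (\prod_(i in S) P (E i))%E.

Section EdwardsAnderson.
Variables (disp : measure_display) (T : measurableType disp) (R : realType).
Variables (P : probability T R) (n : nat).

(* X e indicates whether e is an edge, J e is the coupling; only the sets e of
   cardinal 2 are relevant. Couplings are attached to all potential edges and
   are independent of the graph. *)
Variables (X : {set 'I_n} -> {RV P >-> bool}) (J : {set 'I_n} -> {RV P >-> R}).

Definition generated_events (i : {set 'I_n} + {set 'I_n}) : set (set T) :=
  match i with
  | inl e => preimage_set_system setT (X e) measurable
  | inr e => preimage_set_system setT (J e) measurable
  end.

Definition edge_variables : {set {set 'I_n} + {set 'I_n}} :=
  [set i : {set 'I_n} + {set 'I_n} | match i with inl e | inr e => #|e| == 2%N end]%SET.

Definition edwards_anderson (p : R) : Prop :=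
  [/\ forall e : {set 'I_n}, #|e| = 2%N -> P (X e @^-1` [set true]) = p%:E,
      forall e : {set 'I_n}, #|e| = 2%N ->
        forall B : set R, measurable B ->
          distribution P (J e) B = normal_prob 0 1 B &
      mutually_independent P edge_variables generated_events].

Definition random_graph (w : T) : rel 'I_n :=
  fun u v => (u != v) && X [set u; v]%SET w.

Definition ea_influence (beta : R) (w : T) : {set 'I_n} -> R :=
  fun e => influence beta (J e w).

End EdwardsAnderson.

(* Main.v *)
Require Import Defs.
From HB Require Import structures.
From mathcomp Require Import all_boot all_order all_algebra.
From mathcomp Require Import all_classical all_reals all_analysis.
From mathcomp Require Import measurable_realfun.
From mathcomp Require Import zify ring lra.
Import Order.TTheory GRing.Theory Num.Theory.
Import numFieldNormedType.Exports.
Local Open Scope classical_set_scope.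
Local Open Scope ring_scope.

Set Implicit Arguments.
Unset Strict Implicit.
Unset Printing Implicit Defensive.

(* If a locally simple path P has no block vertex, every vertex u of P starts a path Q_u of
   weight at least 1. Either some Q_u is itself long, or all of them live in the tree around P,
   where a Vitali-type selection extracts vertex-disjoint Q_u whose total size is at least
   |P| / 4. For such a spine-plus-branches structure, the s-th power (s ~ d^(3/4)) of the
   product of the weights is at least 1, and pointwise
   M(v)^s <= (1 - eps/4)^s + d^s exp(tau (A(v) - 1 + eps/2)) with tau = eps d / 96.
   Each edge lies in at most two of the sums A(v), so by independence and the Gaussian bound
   E exp(a |J|) <= exp(a^2/2) (1 + a sqrt(2/pi)) the expectation of that product is at most
   exp(- c d^(5/8)) per vertex, which beats the number of structures, O(d) per vertex.
   To work with finite sums only, the influences are first rounded up to multiples of 1/(N+1). *)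

(** The exponents are dictated by the length of the path: over [ln n / sqrt d] vertices, a bound
    [n ^ (- d^(1/8))] needs a gain [exp (- d^(5/8))] per vertex, on top of the factor O(d) for
    counting. A light vertex, of weight [1 - eps/4], gains only a constant, which cannot even beat
    that counting factor. Hence the power s: it turns the constant into about [exp (- s eps/4)], so
    s must exceed the order of [d^(5/8)]. The power also inflates heavy vertices to order [d^s], and
    this must be paid for by the exponentially small probability, in d, that A(v) exceeds its mean
    by eps/2; so [s ln d] must be small against d. The choice [s ~ d^(3/4)] meets both demands. The
    threshold [beta_c] enters through that mean: [d * (beta/2) * E|J| = d beta / sqrt (2 pi) <= 1 -
    eps]. Disjoint branches alone would cost a factor n for each starting point. The spine ties the
    starting points together, so that only its first vertex costs n. *)

(** * Paths in trees and the selection of disjoint branches *)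

Lemma walk_gpath (V : finType) (e : rel V) (x : V) (p : seq V) :
  path e x p -> exists q, [/\ gpath e x q, last x q = last x p,
    (size q <= size p)%N & {subset x :: q <= x :: p}].
Proof.
move=> /shortenP[q qp uq sub]; exists q; split => //.
- by rewrite /gpath qp.
- apply: uniq_leq_size; last exact: sub.
  by move: uq => /= /andP[].
- move=> z; rewrite !inE => /orP[->//|/sub ->].
  by rewrite orbT.
Qed.

Lemma gpath_catl (V : finType) (e : rel V) (x : V) (p q : seq V) :
  gpath e x (p ++ q) -> gpath e x p.
Proof.
by rewrite /gpath cat_path -cat_cons cat_uniq => /andP[/andP[-> _] /and3P[-> _ _]].
Qed.

Lemma gpath_catr (V : finType) (e : rel V) (x : V) (p q : seq V) :
  gpath e x (p ++ q) -> gpath e (last x p) q.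
Proof.
rewrite /gpath cat_path => /andP[/andP[_ ->] uq] /=.
by move: uq; rewrite -cat_cons lastI cat_rcons cat_uniq => /and3P[_ _].
Qed.

(** Two different paths with the same ends diverge at some vertex and meet again later; the two
    stretches between form a cycle. *)
Lemma acyclic_gpath_unique (V : finType) (e : rel V) (S : set V) :
  symmetric e ->
  (forall c : seq V, (2 < size c)%N -> (forall z, z \in c -> S z) ->
      ~ ucycle e c) ->
  forall x p q, gpath e x p -> gpath e x q -> last x p = last x q ->
    (forall z, z \in x :: p -> S z) -> (forall z, z \in x :: q -> S z) ->
  p = q.
Proof.
move=> esym acyc x p; elim: p x => [|b p' IH] x [|c q'] //=.
- by move=> _ /andP[_ /= /andP[/negP + _]] xq _ _; case; rewrite xq mem_last.
- by move=> /andP[_ /= /andP[/negP + _]] _ xp _ _; case; rewrite -xp mem_last.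
move=> Gp Gq lpq Sp Sq; have [bc|bc] := eqVneq b c.
  subst c; congr cons; apply: (IH b) => //.
  - exact: (@gpath_catr _ e x [:: b] p').
  - exact: (@gpath_catr _ e x [:: b] q').
  - by move=> z zp; apply: Sp; rewrite inE zp orbT.
  - by move=> z zp; apply: Sq; rewrite inE zp orbT.
exfalso.
(* The paths diverge at [x]. Let [z] be the first vertex of the second path that lies on the first
   one: up to [z] they share no inner vertex, so following one and returning along the other is a
   cycle. *)
have hs : has (mem (b :: p')) (c :: q').
  by apply/hasP; exists (last b p'); [rewrite lpq|]; exact: mem_last.
have [z [q1 [q2 [Eq zp nq]]]] : exists z q1 q2,
    [/\ c :: q' = rcons q1 z ++ q2, z \in b :: p' & ~~ has (mem (b :: p')) q1].
  move: (erefl (c :: q')); case: {2}_ / (split_find hs) => z s1 s2 zp ns E.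
  by exists z, s1, s2.
have [p1 [p2 Ep]] : exists p1 p2, b :: p' = rcons p1 z ++ p2.
  move: (erefl (b :: p')); case: {2}_ / (path.splitP zp) => s1 s2 E.
  by exists s1, s2.
have Gp1 : gpath e x (rcons p1 z) by apply: (@gpath_catl _ e x _ p2); rewrite -Ep.
have Gq1 : gpath e x (rcons q1 z) by apply: (@gpath_catl _ e x _ q2); rewrite -Eq.
apply: (acyc (x :: rcons p1 z ++ rev q1)).
- rewrite /= size_cat size_rcons size_rev.
  case: p1 q1 {Gp1 Gq1 nq} Ep Eq => [|? ?] [|? ?] /= Ep Eq; [|lia..].
  by case: Ep Eq => Eb _ [Ec _]; rewrite Eb Ec eqxx in bc.
- move=> v; rewrite inE mem_cat mem_rev => /orP[/eqP->|/orP[vp|vq]].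
  + by apply: Sp; rewrite mem_head.
  + by apply: Sp; rewrite inE Ep mem_cat vp orbT.
  + by apply: Sq; rewrite inE Eq mem_cat mem_rcons inE vq !orbT.
move: Gp1 Gq1 => /andP[Pp Up] /andP[Pq Uq].
apply/andP; split.
  rewrite /= rcons_cat cat_path Pp last_rcons /=.
  have := rev_path e x (rcons q1 z).
  rewrite last_rcons belast_rcons rev_cons => ->.
  by rewrite (eq_path (e' := e)) // => u v; rewrite /= esym.
move: Up Uq => /= /andP[xp up] /andP[xq]; rewrite rcons_uniq => /andP[_ uq1].
rewrite mem_cat negb_or xp mem_rev cat_uniq up rev_uniq uq1 andbT /=.
move: xq; rewrite mem_rcons inE negb_or => /andP[_ ->] /=.
apply: contra nq => /hasP[v]; rewrite mem_rev => vq vp; apply/hasP; exists v => //.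
by rewrite /= Ep mem_cat vp.
Qed.

Lemma gpath_segment (V : finType) (e : rel V) (x : V) (p : seq V) (u v : V) :
  gpath e x p -> u \in x :: p -> v \in x :: p ->
  (index u (x :: p) <= index v (x :: p))%N ->
  exists s, [/\ gpath e u s, last u s = v,
    size s = (index v (x :: p) - index u (x :: p))%N &
    {subset u :: s <= x :: p}].
Proof.
move=> Gp up vp le.
have [p1 [p2 [Ep lu]]] : exists p1 p2, p = p1 ++ p2 /\ last x p1 = u.
  by case/splitPl: up => p1 p2 <-; exists p1, p2.
have Gu : gpath e u p2 by rewrite -lu; apply: gpath_catr; rewrite -Ep.
have Es : x :: p = belast x p1 ++ u :: p2 by rewrite Ep -cat_cons lastI lu cat_rcons.
have us : uniq (x :: p) by case/andP: Gp.
have iu : index u (x :: p) = size p1.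
  move: us; rewrite Es cat_uniq => /and3P[_ /hasPn /(_ u (mem_head _ _)) nu _].
  by rewrite index_cat (negbTE nu) /= eqxx addn0 size_belast.
have vb : v \notin belast x p1.
  apply: contraL le => vb; rewrite -ltnNge iu Es index_cat vb.
  by rewrite -(size_belast x p1) index_mem.
have vu : v \in u :: p2 by move: vp; rewrite Es mem_cat (negbTE vb).
have iv : index v (x :: p) = (size p1 + index v (u :: p2))%N.
  by rewrite Es index_cat (negbTE vb) size_belast.
have [p3 [p4 [Ep2 lv]]] : exists p3 p4, p2 = p3 ++ p4 /\ last u p3 = v.
  by case/splitPl: vu => p3 p4 <-; exists p3, p4.
exists p3; split => //.
- by apply: (@gpath_catl _ e u _ p4); rewrite -Ep2.
- rewrite iv iu addnC addnK.
  move: Gu => /andP[_]; rewrite Ep2 -cat_cons lastI lv cat_rcons cat_uniq.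
  move=> /and3P[_ /hasPn /(_ v (mem_head _ _)) nv _].
  by rewrite index_cat (negbTE nv) /= eqxx addn0 size_belast.
- by move=> z zs; rewrite Es mem_cat Ep2 -cat_cons mem_cat zs orbT.
Qed.

Lemma mem_nbhd (R : realType) (V : finType) (e : rel V) (r : R) x p u q z :
  u \in x :: p -> gpath e u q -> (size q)%:R <= r -> z \in u :: q ->
  nbhd e r x p z.
Proof.
move=> up Gq qr /splitPl zq; case: zq Gq qr => q1 q2 lz Gq qr.
exists u, q1; split => //; first exact: gpath_catl Gq.
by apply: le_trans qr; rewrite ler_nat size_cat leq_addr.
Qed.

(** If the two branches meet at [z], going from [u] to [z] and back to [v] is a walk inside the tree
    around the spine. The path extracted from it is no longer than the branches together, and by
    uniqueness it is the segment of the spine from [u] to [v]. *)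
Lemma locally_simple_dist (R : realType) (V : finType) (e : rel V) (r : R) x p u v q1 q2 z :
  symmetric e -> 0 <= r -> gpath e x p -> locally_simple e r x p ->
  u \in x :: p -> v \in x :: p -> gpath e u q1 -> gpath e v q2 ->
  (size q1)%:R <= r -> (size q2)%:R <= r ->
  z \in u :: q1 -> z \in v :: q2 ->
  (index u (x :: p) <= index v (x :: p))%N ->
  (index v (x :: p) - index u (x :: p) <= size q1 + size q2)%N.
Proof.
move=> esym r0 Gp [_ [_ acyc]] up vp Gq1 Gq2 s1 s2 z1 z2 le.
have [s [Gs ls <- subs]] := gpath_segment Gp up vp le.
have S1 t : t \in u :: q1 -> nbhd e r x p t by apply: mem_nbhd.
have S2 t : t \in v :: q2 -> nbhd e r x p t by apply: mem_nbhd.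
case/splitPl: {s1} z1 Gq1 S1 => a1 a2 la Ga Sa.
case/splitPl: {s2} z2 Gq2 S2 => b1 b2 lb Gb Sb.
have W : path e u (a1 ++ rev (belast v b1)).
  rewrite cat_path; case/andP: (gpath_catl Ga) => -> _ /=.
  rewrite la -lb rev_path (eq_path (e' := e)); last by move=> ? ?; rewrite /= esym.
  by case/andP: (gpath_catl Gb).
have lW : last u (a1 ++ rev (belast v b1)) = v.
  rewrite last_cat la; case: b1 {W Gb Sb} lb => [|b b1] //= _.
  by rewrite rev_cons last_rcons.
have [t [Gt lt st subt]] := walk_gpath W.
have -> : s = t.
  apply: (acyclic_gpath_unique esym acyc Gs Gt); first by rewrite lt lW.
    by move=> y ys; apply: (@mem_nbhd _ _ _ _ _ _ y [::] y); rewrite ?mem_head//; exact: subs.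
  move=> y /subt; rewrite inE mem_cat mem_rev => /orP[/eqP->|/orP[ya|yb]].
  - by apply: Sa; rewrite mem_head.
  - by apply: Sa; rewrite inE mem_cat ya orbT.
  - by apply: Sb; rewrite -cat_cons mem_cat mem_belast.
apply: (leq_trans st); rewrite !size_cat size_rev size_belast.
by rewrite leq_add// leq_addr.
Qed.

(* Greedy choice, largest radius first, as in the Vitali covering lemma. *)
Lemma separated_subset (I : finType) (f k : I -> nat) (A : {set I}) :
  {in A &, injective f} ->
  exists D : {set I}, [/\ D \subset A,
    {in D &, forall i j, i != j -> (f i <= f j)%N -> (k i + k j < f j - f i)%N} &
    (#|A| <= \sum_(i in D) (4 * k i).+1)%N].
Proof.
move: {2}_.+1 (ltnSn #|A|) => m; elim: m A => // m IH A Am inj.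
have [->|[i0 i0A]] := set_0Vmem A.
  by exists finset.set0; split; rewrite ?sub0set ?cards0 // => i j; rewrite inE.
have [i iA imax] : exists2 i, i \in A & forall j, j \in A -> (k j <= k i)%N.
  by case: (@arg_maxnP _ i0 (mem A) k i0A) => i iA h; exists i.
(* Subtraction is truncated, so the two conditions together say that [f i] and [f j] differ by at
   most [2 * k i]. An index left outside [B] is then further than [k i + k j] from [i], because
   [k i] is maximal. *)
pose B := [set j in A | (f j - f i <= 2 * k i) && (f i - f j <= 2 * k i)]%N%SET.
have cB : (#|B| <= (4 * k i).+1)%N.
  pose s := iota (f i - 2 * k i) (4 * k i).+1.
  have injB : {in B &, injective f}.
    by move=> a b; rewrite !inE => /andP[aA _] /andP[bA _]; apply: inj.
  have -> : #|B| = size (map f (enum B)) by rewrite size_map -cardE.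
  rewrite -(size_iota (f i - 2 * k i) (4 * k i).+1); apply: uniq_leq_size.
    rewrite map_inj_in_uniq ?enum_uniq// => a b.
    by rewrite !mem_enum; exact: injB.
  move=> y /mapP[j]; rewrite mem_enum inE => /andP[_ /andP[h1 h2]] ->.
  rewrite mem_iota; lia.
have iB : i \in B by rewrite inE iA !subnn.
have BA : B \subset A by apply/fintype.subsetP => j; rewrite inE => /andP[].
have [|a b|D [DA sep cD]] := IH (A :\: B)%SET.
- rewrite -ltnS; apply: leq_trans Am; rewrite ltnS; apply: proper_card.
  by apply/properP; split; [exact: subsetDl|exists i => //; rewrite inE iB].
- by rewrite !inE => /andP[_ aA] /andP[_ bA]; apply: inj.
have DA' j : j \in D -> j \in A /\ ((2 * k i < f j - f i) || (2 * k i < f i - f j))%N.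
  move=> /(fintype.subsetP DA); rewrite !inE => /andP[+ jA]; rewrite jA /=; split => //.
  lia.
have iD : i \notin D by apply/negP => /DA' []; rewrite !subnn.
exists (i |: D)%SET; split.
- apply/fintype.subsetP => j; rewrite !inE => /orP[/eqP->//|/DA' []//].
- move=> a b; rewrite !inE => /orP[/eqP->|aD] /orP[/eqP->|bD]; rewrite ?eqxx//.
  + by move: (DA' _ bD) => [bA h]; have := imax _ bA; lia.
  + by move: (DA' _ aD) => [aA h]; have := imax _ aA; lia.
  + exact: sep.
- rewrite big_setU1//=; move: cD; rewrite cardsD.
  rewrite (finset.setIidPr BA); move: cB; lia.
Qed.

(** The selection is applied to the positions on the spine, with the branch lengths as radii:
    positions further apart than the two lengths force disjoint branches, by
    [locally_simple_dist]. *)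
Lemma locally_simple_disjoint_family (R : realType) (V : finType) (e : rel V) (r : R) x p
    (Q : V -> seq V) :
  symmetric e -> 0 <= r -> gpath e x p -> locally_simple e r x p ->
  (forall u, u \in x :: p -> gpath e u (Q u) /\ (size (Q u))%:R <= r) ->
  exists D : {set V}, [/\ {subset D <= x :: p},
    {in D &, forall u v, u != v -> forall z, z \in u :: Q u -> z \notin v :: Q v} &
    ((size p).+1 <= \sum_(u in D) 4 * (size (Q u)).+1)%N].
Proof.
move=> esym r0 Gp ls HQ.
have [|D [DA sep cD]] := @separated_subset V (index^~ (x :: p)) (fun u => size (Q u))
    [set u in x :: p]%SET.
  move=> u v; rewrite !inE => up vp.
  by apply: index_inj.
have Dp : {subset D <= x :: p} by move=> u /(fintype.subsetP DA); rewrite inE.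
exists D; split => //.
- move=> u v uD vD uv z zu; apply/negP => zv.
  wlog le : u v uD vD uv zu zv / (index u (x :: p) <= index v (x :: p))%N.
    case/orP: (leq_total (index u (x :: p)) (index v (x :: p))) => h hw.
      by apply: (hw u v).
    by apply: (hw v u) => //; rewrite eq_sym.
  have [Gu su] := HQ _ (Dp _ uD); have [Gv sv] := HQ _ (Dp _ vD).
  have := sep _ _ uD vD uv le.
  by rewrite ltnNge (locally_simple_dist esym r0 Gp ls (Dp _ uD) (Dp _ vD) Gu Gv su sv zu zv le).
- have Up : uniq (x :: p) by case/andP: Gp.
  have -> : (size p).+1 = #|[set u in x :: p]%SET| by rewrite cardsE (card_uniqP Up).
  apply: (leq_trans cD); apply: leq_sum => u _; lia.
Qed.

(** * Edges of a path and weighted sums over walks *)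

Fixpoint edges (V : finType) (s : seq V) : seq {set V} :=
  if s is a :: s' then
    (if s' is b :: _ then [:: [set a; b]%SET] else [::]) ++ edges s'
  else [::].

Lemma mem_edges (V : finType) (s : seq V) e z : e \in edges s -> z \in e -> z \in s.
Proof.
elim: s => [|a [|b s] IH] //=; rewrite inE => /orP[/eqP->|/IH h].
  by rewrite !inE => /orP[] ->; rewrite ?orbT.
by move=> /h zs; rewrite inE zs orbT.
Qed.

Lemma card_edges (V : finType) (s : seq V) e : uniq s -> e \in edges s -> #|e| = 2.
Proof.
elim: s => [|a [|b s] IH] //= /andP[ab us]; rewrite inE => /orP[/eqP->|]; last exact: IH.
by rewrite cards2; move: ab; rewrite inE negb_or => /andP[->].
Qed.

Lemma uniq_edges (V : finType) (s : seq V) : uniq s -> uniq (edges s).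
Proof.
elim: s => [|a [|b s] IH] //= /andP[ab us]; rewrite IH// andbT.
by apply: contra ab => eb; exact: (@mem_edges _ (b :: s) _ a eb (set21 a b)).
Qed.

Lemma size_edges (V : finType) (x : V) (p : seq V) : size (edges (x :: p)) = size p.
Proof. by elim: p x => //= a p IH x; congr S; exact: IH. Qed.

Lemma uniq_flatten_edges (V : finType) (ss : seq (seq V)) :
  uniq (flatten ss) -> uniq (flatten (map (@edges V) ss)).
Proof.
elim: ss => //= s ss IH; rewrite !cat_uniq => /and3P[us dis uss].
rewrite uniq_edges// IH// andbT /=; apply: contra dis.
move=> /hasP[e /flatten_mapP[s' s's es'] es].
have /card_gt0P[z ze] : (0 < #|e|)%N by rewrite (card_edges us es).
apply/hasP; exists z; last exact: mem_edges es ze.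
by apply/flattenP; exists s' => //; exact: mem_edges es' ze.
Qed.

Lemma path_edges (V : finType) (X : {set V} -> bool) (x : V) (p : seq V) :
  path (fun u v => (u != v) && X [set u; v]%SET) x p -> all X (edges (x :: p)).
Proof.
elim: p x => //= a p IH x /andP[/andP[_ ->] h] /=; exact: IH.
Qed.

Lemma eq_set2 (V : finType) (u v a b : V) : [set u; v]%SET = [set a; b]%SET ->
  ((u == a) && (v == b)) || ((u == b) && (v == a)).
Proof.
move=> E.
have /set2P h1 : u \in [set a; b]%SET by rewrite -E set21.
have /set2P h2 : v \in [set a; b]%SET by rewrite -E set22.
have /set2P h3 : a \in [set u; v]%SET by rewrite E set21.
have /set2P h4 : b \in [set u; v]%SET by rewrite E set22.
case: h1 => h1; case: h2 => h2; case: h3 => h3; case: h4 => h4; subst.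
all: by rewrite ?eqxx ?orbT.
Qed.

(** This bounds the number of spine edges that a branch can follow from a given vertex. *)
Lemma edges_degree (V : finType) (s : seq V) (u : V) : uniq s ->
  (\sum_v ([set u; v]%SET \in edges s) <= 2)%N.
Proof.
case: s => [|a s]; first by rewrite big1.
(* The head has one neighbour in the list and every later occurrence of [u] at most two. In this
   form the induction can drop uniqueness. *)
move=> us; apply: (@leq_trans ((u == a) + 2 * count_mem u s)); last first.
  move: us => /= /andP[as_ us]; case: eqP => [->|_]; first by rewrite (count_memPn as_).
  by rewrite (count_uniq_mem _ us); case: (_ \in _).
move=> {us}; elim: s a => [|b s IH] a; first by rewrite big1.
apply: (@leq_trans ((\sum_v (((u == a) && (v == b)) + ((u == b) && (v == a)))) +
    \sum_v ([set u; v]%SET \in edges (b :: s)))).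
  rewrite -big_split; apply: leq_sum => v _.
  rewrite /= inE; case: eqP => [E|_] /=; last by rewrite leq_addl.
  apply: leq_trans (leq_addr _ _).
  by have [/andP[-> ->]//|/andP[-> ->]] := orP (eq_set2 E); rewrite addnC.
have sum1 (c : V) : (\sum_v (v == c) = 1)%N.
  by rewrite (bigD1 c)//= eqxx big1 // => i /negbTE ->.
have -> : (\sum_v (((u == a) && (v == b)) + ((u == b) && (v == a))) = (u == a) + (u == b))%N.
  rewrite big_split /=; congr addn; under eq_bigr do rewrite -mulnb;
  by rewrite -big_distrr /= sum1 muln1.
apply: leq_trans (leq_add (leqnn _) (IH b)) _.
by rewrite /= (eq_sym b u); lia.
Qed.

Lemma sum_tuple_cons (R : nmodType) (T : finType) (k : nat) (F : seq T -> R) :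
  \sum_(t : k.+1.-tuple T) F t = \sum_x \sum_(t : k.-tuple T) F (x :: t).
Proof.
rewrite pair_bigA /=.
rewrite (reindex (fun p : T * k.-tuple T => [tuple of p.1 :: p.2]))//=.
exists (fun t : k.+1.-tuple T => (thead t, [tuple of behead t])) => [[x t] _|t _] /=.
  by rewrite theadE; congr pair; apply: val_inj.
by rewrite [RHS]tuple_eta.
Qed.

Lemma sum_walks_le (R : realType) (V : finType) (w : {set V} -> R) (c : R) (u : V) k :
  (forall e, 0 <= w e) -> (forall u, \sum_v w [set u; v]%SET <= c) ->
  \sum_(t : k.-tuple V) \prod_(e <- edges (u :: t)) w e <= c ^+ k.
Proof.
move=> w0 wc; have c0 : 0 <= c by apply: le_trans (wc u); apply: sumr_ge0.
elim: k u => [|k IH] u.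
  rewrite (eq_bigr (fun=> 1)); last by move=> t _; rewrite (tuple0 t) /= big_nil.
  by rewrite sumr_const card_tuple expn0.
rewrite (sum_tuple_cons _ (fun t => \prod_(e <- edges (u :: t)) w e)).
rewrite exprS; apply: (@le_trans _ _ (\sum_v w [set u; v]%SET * c ^+ k)).
  apply: ler_sum => v _; under eq_bigr do rewrite big_cons -/edges.
  by rewrite -big_distrr /= ler_wpM2l//; exact: IH.
by rewrite -big_distrl /= ler_wpM2r ?exprn_ge0.
Qed.

Lemma big_option (R : nmodType) (T : finType) (F : option T -> R) :
  \sum_o F o = F None + \sum_x F (Some x).
Proof.
rewrite (bigD1 None)//=; congr (_ + _).
rewrite (reindex_omap Some id)//=; last by case.
by apply: eq_bigl => x; rewrite eqxx.
Qed.

(** * Exponential moments on the finite product space of configurations *)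

Section ProductExpectation.
Variables (R : realType) (n N : nat) (p : R) (q g : 'I_N.+1 -> R).

(* Sets of cardinal other than two are not edges: they carry a point mass. *)
Definition edge_weight (e : {set 'I_n}) (b : bool * 'I_N.+1) : R :=
  if #|e| == 2%N then (if b.1 then p else 1 - p) * q b.2
  else (b == (false, ord0))%:R.

Definition config_weight (om : {ffun {set 'I_n} -> bool * 'I_N.+1}) : R :=
  \prod_e edge_weight e (om e).

(** The rounded A(v), summed over all pairs containing [v] with the edge indicator as a factor, so
    that it is a sum of functions of independent coordinates. *)
Definition config_influence (om : {ffun {set 'I_n} -> bool * 'I_N.+1}) (v : 'I_n) : R :=
  \sum_(e : {set 'I_n} | (#|e| == 2%N) && (v \in e)) (om e).1%:R * g (om e).2.

Lemma sum_config_weight_prod (f : {set 'I_n} -> bool * 'I_N.+1 -> R) :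
  \sum_om config_weight om * \prod_e f e (om e) =
  \prod_e \sum_b edge_weight e b * f e b.
Proof.
by rewrite bigA_distr_bigA /=; apply: eq_bigr => om _; rewrite -big_split.
Qed.

Lemma all_prod (I : finType) (F : seq I) (P : pred I) :
  (all P F)%:R = \prod_i ((i \in F) ==> P i)%:R :> R.
Proof.
have [/allP h|/allPn[i iF nP]] := boolP (all P F).
  by rewrite big1// => i _; case: (boolP (i \in F)) => //= /h ->.
by rewrite (bigD1 i)//= iF (negbTE nP) mul0r.
Qed.

Lemma card_edges_at (v : 'I_n) :
  (#|[set e : {set 'I_n} | (#|e| == 2%N) && (v \in e)]%SET| <= n)%N.
Proof.
rewrite -[leqRHS](card_ord n) -cardsT.
apply: leq_trans (leq_imset_card (fun u => [set v; u]%SET) _).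
apply: subset_leq_card; apply/fintype.subsetP => e; rewrite inE => /andP[/cards2P[a [b [ab ->]]]].
move=> /set2P[->|->]; apply/imsetP; [by exists b|by exists a => //; rewrite finset.setUC].
Qed.

Variables (tau h : R).
Hypotheses (p0 : 0 <= p) (p1 : p <= 1) (q0 : forall j, 0 <= q j) (h0 : 0 <= h) (h1 : h <= 1).
Hypothesis moment : forall c : nat, (c <= 2)%N ->
  \sum_j q j * expR (tau * (c%:R * g j)) <= 1 + c%:R * h.

Lemma edge_weight_ge0 e b : 0 <= edge_weight e b.
Proof.
rewrite /edge_weight; case: ifP => // _; apply: mulr_ge0 => //.
by case: ifP => // _; rewrite subr_ge0.
Qed.

(** The multiplicity with which the influence of [e] enters the sum of A(v) over [D]. *)
Definition degree_in (D : seq 'I_n) (e : {set 'I_n}) : nat :=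
  if #|e| == 2%N then count (mem e) D else 0.

Lemma degree_in_le2 D e : uniq D -> (degree_in D e <= 2)%N.
Proof.
move=> uD; rewrite /degree_in; case: ifP => // /eqP ce; rewrite -ce -size_filter cardE.
apply: uniq_leq_size; first exact: filter_uniq.
by move=> z; rewrite mem_filter mem_enum => /andP[].
Qed.

Lemma sum_config_influence (D : seq 'I_n) om :
  \sum_(v <- D) config_influence om v =
  \sum_e (degree_in D e)%:R * ((om e).1%:R * g (om e).2).
Proof.
under eq_bigr do rewrite /config_influence big_mkcond.
rewrite exchange_big /=; apply: eq_bigr => e _; rewrite /degree_in.
case: ifP => /= _; last by rewrite mul0r big1.
by rewrite -big_mkcond big_const_seq iter_addr_0 [RHS]mulr_natl.
Qed.

Lemma sum_degree_in (D : seq 'I_n) : (\sum_e degree_in D e <= size D * n)%N.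
Proof.
have -> : (\sum_e degree_in D e =
    \sum_(v <- D) #|[set e : {set 'I_n} | (#|e| == 2%N) && (v \in e)]%SET|)%N.
  transitivity (\sum_(e : {set 'I_n}) \sum_(v <- D) ((#|e| == 2%N) && (v \in e) : nat))%N.
    apply: eq_bigr => e _; rewrite /degree_in; case: ifP => _ /=; last by rewrite big1.
    by rewrite -sum1_count big_mkcond /=; apply: eq_bigr => v _; case: ifP.
  rewrite exchange_big /=; apply: eq_bigr => v _.
  by rewrite -sum1_card [RHS]big_mkcond /=; apply: eq_bigr => e _; rewrite inE; case: ifP.
rewrite -sum1_size big_distrl /=; apply: leq_sum => v _; rewrite mul1n.
exact: card_edges_at.
Qed.

(** A forced edge contributes p times a moment of at most [1 + 2 * h <= 3]. A free one contributes
    at most [(1 - p) + p * (1 + c * h)], which is at most [expR (p * c * h)] for multiplicity c. *)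
Lemma edge_moment (D : seq 'I_n) (F : seq {set 'I_n}) e : uniq D ->
  all (fun e : {set 'I_n} => #|e| == 2%N) F ->
  \sum_b edge_weight e b * (((e \in F) ==> b.1)%:R *
      expR (tau * ((degree_in D e)%:R * (b.1%:R * g b.2)))) <=
  (if e \in F then 3 * p else 1) * expR (p * (degree_in D e)%:R * h).
Proof.
move=> uD /allP F2; have c2 := degree_in_le2 e uD.
case: (boolP (#|e| == 2%N)) => [e2|e2]; last first.
  have -> : degree_in D e = 0%N by rewrite /degree_in (negbTE e2).
  have -> : (e \in F) = false by apply/negP => /F2; rewrite (negbTE e2).
  rewrite (bigD1 (false, ord0)) //= big1 ?addr0; last first.
    by move=> b /negbTE nb; rewrite /edge_weight (negbTE e2) nb mul0r.
  by rewrite /edge_weight (negbTE e2) eqxx /= !(mul0r, mulr0, expR0, mulr1).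
move: (degree_in D e) c2 => c c2.
rewrite -(pair_bigA _ (fun x j => edge_weight e (x, j) * (((e \in F) ==> x)%:R *
      expR (tau * (c%:R * (x%:R * g j)))))) /= big_bool /=.
have -> : \sum_j edge_weight e (true, j) * (((e \in F) ==> true)%:R *
    expR (tau * (c%:R * (1 * g j)))) = p * \sum_j q j * expR (tau * (c%:R * g j)).
  rewrite big_distrr; apply: eq_bigr => j _.
  by rewrite /edge_weight e2 /= implybT [true%:R]mulr1n !mul1r [RHS]mulrA.
have -> : \sum_j edge_weight e (false, j) * (((e \in F) ==> false)%:R *
    expR (tau * (c%:R * (0 * g j)))) = (e \notin F)%:R * ((1 - p) * \sum_j q j).
  rewrite !big_distrr; apply: eq_bigr => j _.
  by rewrite /edge_weight e2 /= implybF !(mul0r, mulr0) expR0 mulr1 mulrC.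
have M := moment c2.
have M0 : \sum_j q j <= 1.
  have := moment (isT : (0 <= 2)%N); rewrite mul0r addr0; apply: le_trans.
  by apply: ler_sum => j _; rewrite mul0r mulr0 expR0 mulr1.
have cR : c%:R <= 2 :> R by rewrite ler_nat.
have cR0 : 0 <= c%:R :> R by [].
have pch : 0 <= p * c%:R * h by rewrite !mulr_ge0.
have E1 : 1 + p * c%:R * h <= expR (p * c%:R * h) by exact: expR_ge1Dx.
have E2 : p * (\sum_j q j * expR (tau * (c%:R * g j))) <= p * (1 + c%:R * h).
  exact: ler_wpM2l.
case: (e \in F) => /=; rewrite ?mul0r ?mul1r ?addr0.
  apply: (le_trans E2); apply: (@le_trans _ _ (3 * p * 1)).
    have ch : c%:R * h <= 2 * 1 by apply: ler_pM.
    by rewrite mulr1 mulrC ler_wpM2r//; lra.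
  by rewrite ler_wpM2l ?mulr_ge0//; lra.
apply: le_trans E1; have : (1 - p) * \sum_j q j <= (1 - p) * 1.
  by rewrite ler_wpM2l// subr_ge0.
lra.
Qed.

(** By independence the expectation is a product over pairs. Every vertex of [D] lies in at most n
    pairs, so the exponents [p * degree_in D e * h] add up to at most [n * p * h] per vertex. *)
Lemma forced_moment (D : seq 'I_n) (F : seq {set 'I_n}) : uniq D ->
  all (fun e : {set 'I_n} => #|e| == 2%N) F ->
  \sum_om config_weight om * ((all (fun e => (om e).1) F)%:R *
    \prod_(v <- D) expR (tau * config_influence om v)) <=
  (\prod_e if e \in F then 3 * p else 1) * expR (n%:R * p * h) ^+ size D.
Proof.
move=> uD F2.
pose f e (b : bool * 'I_N.+1) : R := ((e \in F) ==> b.1)%:R *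
      expR (tau * ((degree_in D e)%:R * (b.1%:R * g b.2))).
rewrite (eq_bigr (fun om => config_weight om * \prod_e f e (om e))); last first.
  move=> om _; congr (_ * _); rewrite all_prod -expR_sum -big_distrr /=.
  rewrite sum_config_influence big_distrr /= expR_sum -big_split.
  exact: eq_bigr.
rewrite sum_config_weight_prod.
apply: (@le_trans _ _ (\prod_e ((if e \in F then 3 * p else 1) *
    expR (p * (degree_in D e)%:R * h)))).
  apply: ler_prod => e _; rewrite edge_moment// andbT.
  apply: sumr_ge0 => b _; apply: mulr_ge0; first exact: edge_weight_ge0.
  by apply: mulr_ge0 => //; exact: expR_ge0.
rewrite big_split /= ler_wpM2l//.
  by apply: prodr_ge0 => e _; case: ifP => // _; rewrite mulr_ge0.
rewrite -expR_sum -expRM_natl ler_expR -big_distrl -big_distrr /= -natr_sum.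
rewrite mulrA mulrA ler_wpM2r// mulrC ler_wpM2r// -natrM ler_nat.
exact: sum_degree_in.
Qed.

Variables (a b : R).
Hypotheses (a0 : 0 <= a) (b0 : 0 <= b).

(** Expanding the product over [S] leaves the moments of [forced_moment]. In the induction, [D]
    collects the vertices at which the exponential term has been chosen. *)
Lemma forced_weight_moment (S D : seq 'I_n) (F : seq {set 'I_n}) : uniq (D ++ S) ->
  all (fun e : {set 'I_n} => #|e| == 2%N) F ->
  \sum_om config_weight om * ((all (fun e => (om e).1) F)%:R *
    (\prod_(v <- D) expR (tau * config_influence om v)) *
    \prod_(v <- S) (a + b * expR (tau * config_influence om v))) <=
  (\prod_e if e \in F then 3 * p else 1) * expR (n%:R * p * h) ^+ size D *
    (a + b * expR (n%:R * p * h)) ^+ size S.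
Proof.
elim: S D => [|v S IH] D uD F2.
  rewrite cats0 in uD; rewrite expr0 mulr1; apply: le_trans (forced_moment uD F2).
  by apply: ler_sum => om _; rewrite big_nil mulr1.
have uD1 : uniq (D ++ S).
  by apply: subseq_uniq uD; apply: cat_subseq => //; exact: subseq_cons.
have uD2 : uniq ((v :: D) ++ S) by move: uD; rewrite -[v :: S]cat1s uniq_catCA.
have I1 := IH _ uD1 F2; have I2 := IH _ uD2 F2.
set C := (\prod_e _) in I1 I2 *; set G := expR _ in I1 I2 *.
apply: (@le_trans _ _ (a * (C * G ^+ size D * (a + b * G) ^+ size S) +
   b * (C * G ^+ size (v :: D) * (a + b * G) ^+ size S))); last first.
  rewrite /= !exprS le_eqVlt; apply/orP; left; apply/eqP; ring.
apply: le_trans (lerD (ler_wpM2l a0 I1) (ler_wpM2l b0 I2)).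
rewrite !big_distrr -big_split /=; apply: ler_sum => om _.
rewrite !big_cons le_eqVlt; apply/orP; left; apply/eqP; ring.
Qed.

End ProductExpectation.

(** * Spine-and-branch structures and their expected total weight *)

(** [None] stands for no branch at the vertex. Bounding the length by n makes the type finite, and a
    path with distinct vertices always fits. *)
Definition branch (n : nat) : finType := option {k : 'I_n & k.-tuple 'I_n}.

Definition branch_vertices (n : nat) (u : 'I_n) (o : branch n) : seq 'I_n :=
  if o is Some t then u :: tagged t else [::].

Definition family_vertices (n : nat) (phi : {ffun 'I_n -> branch n}) : seq 'I_n :=
  flatten [seq branch_vertices u (phi u) | u <- enum 'I_n].

Definition family_edges (n : nat) (phi : {ffun 'I_n -> branch n}) : seq {set 'I_n} :=
  flatten [seq edges (branch_vertices u (phi u)) | u <- enum 'I_n].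

Definition admissible (n : nat) (x : 'I_n) (s : seq 'I_n) (phi : {ffun 'I_n -> branch n}) :=
  [&& uniq (x :: s), uniq (family_vertices phi),
      [forall u, (phi u != None) ==> (u \in x :: s)] &
      (size s < 4 * size (family_vertices phi))%N].

Lemma admissible_card2 (n : nat) (x : 'I_n) (s : seq 'I_n) (phi : {ffun 'I_n -> branch n}) :
  admissible x s phi ->
  all (fun e : {set 'I_n} => #|e| == 2%N) (edges (x :: s) ++ family_edges phi).
Proof.
case/and4P => us uphi _ _.
rewrite all_cat; apply/andP; split; apply/allP => e; first by move=> /card_edges ->.
move=> /flatten_mapP[u _] /card_edges ->//.
move: uphi; rewrite /family_vertices; have : u \in enum 'I_n by rewrite mem_enum.
elim: (enum _) => //= v l IH; rewrite inE cat_uniq => /orP[/eqP <- /and3P[]//|ul /and3P[_ _]].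
exact: IH.
Qed.

Section Structures.
Variables (R : realType) (n N : nat) (p : R) (q g : 'I_N.+1 -> R) (tau h a b rho sig : R).

(** With a and b from [vweight_pow_le], this is at least 1 whenever the structure is present in the
    graph and the product of its vertex weights is at least 1. *)
Definition structure_weight (x : 'I_n) (s : seq 'I_n) (phi : {ffun 'I_n -> branch n})
    (om : {ffun {set 'I_n} -> bool * 'I_N.+1}) : R :=
  (admissible x s phi)%:R * ((all (fun e => (om e).1) (edges (x :: s) ++ family_edges phi))%:R *
    \prod_(v <- family_vertices phi) (a + b * expR (tau * config_influence g om v))).

Hypotheses (p0 : 0 <= p) (p1 : p <= 1) (q0 : forall j, 0 <= q j) (h0 : 0 <= h) (h1 : h <= 1).
Hypothesis moment : forall c : nat, (c <= 2)%N ->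
  \sum_j q j * expR (tau * (c%:R * g j)) <= 1 + c%:R * h.
Hypotheses (a0 : 0 <= a) (b0 : 0 <= b) (rho0 : 0 <= rho) (sig0 : 0 <= sig) (sig1 : sig <= 1).
Hypothesis small_weight : a + b * expR (n%:R * p * h) <= rho * sig ^+ 4.
Hypothesis summable : rho * (3 + 3 * (n%:R * p)) <= 1.

Lemma structure_weight_ge0 x s phi om : 0 <= structure_weight x s phi om.
Proof.
apply: mulr_ge0 => //; apply: mulr_ge0 => //; apply: prodr_ge0 => v _.
by rewrite addr_ge0// mulr_ge0// expR_ge0.
Qed.

(* An edge of a branch that lies on the spine [x :: s] is already paid for by the spine. *)
Definition step_weight (x : 'I_n) (s : seq 'I_n) (e : {set 'I_n}) : R :=
  if e \in edges (x :: s) then 1 else 3 * p.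

Lemma step_weight_ge0 x s e : 0 <= step_weight x s e.
Proof. by rewrite /step_weight; case: ifP => // _; rewrite mulr_ge0. Qed.

(** At most two steps from [u] follow the spine and cost 1; the at most n others cost [3 * p]
    each. *)
Lemma sum_step_weight x s u : uniq (x :: s) ->
  \sum_v step_weight x s [set u; v]%SET <= 2 + 3 * (n%:R * p).
Proof.
move=> us; apply: (@le_trans _ _ (\sum_v (([set u; v]%SET \in edges (x :: s))%:R + 3 * p))).
  apply: ler_sum => v _; rewrite /step_weight; case: (_ \in _) => /=; rewrite ?add0r//.
  by rewrite lerDl mulr_ge0.
rewrite big_split /= -natr_sum lerD//; first by rewrite (ler_nat _ _ 2); exact: (edges_degree u us).
by rewrite sumr_const card_ord -[leLHS]mulr_natl [leLHS]mulrCA.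
Qed.

(** The share of the bound that is charged to the branch at [u]: [rho] for each of its vertices pays
    for the choice of the walk. The membership factor excludes branches that start off the spine. *)
Definition branch_weight x s u (o : branch n) : R :=
  if o is Some _ then (u \in x :: s)%:R * ((\prod_(e <- edges (branch_vertices u o)) step_weight x s e) *
    rho ^+ size (branch_vertices u o)) else 1.

Lemma branch_weight_ge0 x s u o : 0 <= branch_weight x s u o.
Proof.
rewrite /branch_weight; case: o => // t; rewrite !mulr_ge0 ?exprn_ge0//.
by apply: prodr_ge0 => e _; exact: step_weight_ge0.
Qed.

(** On the spine, having no branch contributes 1, and the branches of all lengths together
    contribute at most 1 because [rho * (1 + c) <= 1], where [c] bounds the total weight of one
    step. *)
Lemma sum_branch_weight x s u : uniq (x :: s) ->
  \sum_o branch_weight x s u o <= if u \in x :: s then 2 else 1.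
Proof.
move=> us; rewrite big_option /=; case: (u \in x :: s); last first.
  by rewrite big1 ?addr0// => t _; rewrite mul0r.
rewrite [2](_ : 2 = 1 + 1)// lerD2l.
set c := 2 + 3 * (n%:R * p).
have c0 : 0 <= c by rewrite /c addr_ge0// !mulr_ge0.
apply: (@le_trans _ _ (\sum_(k < n) rho ^+ k.+1 * c ^+ k)).
  rewrite [X in X <= _](eq_bigr (fun t : {k : 'I_n & k.-tuple 'I_n} =>
      (\prod_(e <- edges (u :: tagged t)) step_weight x s e) * rho ^+ (tag t).+1)); last first.
    by move=> t _; rewrite mul1r /= size_tuple.
  rewrite -(sig_big_dep xpredT (fun _ => xpredT) (fun (k : 'I_n) (t : k.-tuple 'I_n) =>
      (\prod_(e <- edges (u :: t)) step_weight x s e) * rho ^+ k.+1)) /=.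
  apply: ler_sum => k _; rewrite -big_distrl /= mulrC ler_wpM2l ?exprn_ge0//.
  apply: sum_walks_le => [e|v]; first exact: step_weight_ge0.
  exact: sum_step_weight.
(* Each term [rho * (rho * c) ^+ k] is at most [(rho * c) ^+ k - (rho * c) ^+ k.+1], so the sum
   telescopes. *)
have geo k : \sum_(i < k) rho ^+ i.+1 * c ^+ i <= 1 - (rho * c) ^+ k.
  elim: k => [|k IH]; first by rewrite big_ord0 expr0 subrr.
  rewrite big_ord_recr /=; apply: (le_trans (lerD IH (lexx _))).
  have -> : rho ^+ k.+1 * c ^+ k = rho * (rho * c) ^+ k by rewrite exprS -mulrA -exprMn.
  rewrite [(rho * c) ^+ k.+1]exprS.
  have : 0 <= (rho * c) ^+ k by rewrite exprn_ge0// mulr_ge0.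
  have : rho * (1 + c) <= 1 by apply: le_trans summable; rewrite ler_wpM2l// /c; lra.
  by move: ((rho * c) ^+ k) => z Hs Hz; nra.
by apply: (le_trans (geo n)); rewrite gerBl exprn_ge0// mulr_ge0.
Qed.

Lemma prod_mem_if (I : finType) (r : seq I) (f : I -> R) : uniq r ->
  \prod_(i <- r) f i = \prod_i (if i \in r then f i else 1).
Proof. by move=> ur; rewrite big_uniq// big_mkcond. Qed.

(** Every branch vertex earns [rho * sig ^+ 4]. The factors [rho] go into [branch_weight]; the
    factors [sig], four per branch vertex, suffice for one per spine vertex by the size condition in
    [admissible]. *)
Lemma expected_structure_weight x s phi :
  \sum_om config_weight p q om * structure_weight x s phi om <=
  (uniq (x :: s))%:R * ((3 * p) ^+ size s * sig ^+ (size s).+1 *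
    \prod_u branch_weight x s u (phi u)).
Proof.
rewrite /structure_weight; case: (boolP (admissible x s phi)) => [|_]; last first.
  rewrite big1; last by move=> om _; rewrite mul0r mulr0.
  rewrite mulr_ge0// !mulr_ge0 ?exprn_ge0 ?mulr_ge0//.
  by apply: prodr_ge0 => u _; exact: branch_weight_ge0.
move=> adm; have F2 := admissible_card2 adm; case/and4P: adm => us uphi /forallP sup K.
have uFQ : uniq (family_edges phi) by rewrite /family_edges map_comp uniq_flatten_edges.
rewrite us mul1r.
have := @forced_weight_moment R n N p q g tau h p0 p1 q0 h0 h1 moment a b a0 b0
  (family_vertices phi) [::] _ uphi F2.
rewrite /= expr0 mulr1 => M.
apply: (@le_trans _ _ ((\prod_e (if e \in edges (x :: s) ++ family_edges phi then 3 * p else 1)) *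
   (rho * sig ^+ 4) ^+ size (family_vertices phi))).
  apply: (@le_trans _ _ _ _ _ (le_trans _ M)).
    by apply: ler_sum => om _; rewrite big_nil mulr1 mul1r.
  rewrite ler_wpM2l//; last first.
    by apply: lerXn2r => //; rewrite nnegrE ?mulr_ge0 ?exprn_ge0// addr_ge0// mulr_ge0// expR_ge0.
  by apply: prodr_ge0 => e _; case: ifP => // _; rewrite mulr_ge0.
have -> : \prod_e (if e \in edges (x :: s) ++ family_edges phi then 3 * p else 1) =
    (3 * p) ^+ size s * \prod_(e <- family_edges phi) step_weight x s e.
  have -> : (3 * p) ^+ size s = \prod_(e <- edges (x :: s)) (3 * p).
    by rewrite big_const_seq count_predT size_edges -Monoid.iteropE /=.
  rewrite (prod_mem_if _ (uniq_edges us)) (prod_mem_if _ uFQ) -big_split; apply: eq_bigr => e _ /=.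
  rewrite mem_cat /step_weight; case: (e \in edges _) => /=; first by case: ifP; rewrite mulr1.
  by rewrite mul1r.
rewrite -!mulrA ler_wpM2l ?exprn_ge0 ?mulr_ge0//.
have -> : \prod_u branch_weight x s u (phi u) =
    (\prod_(e <- family_edges phi) step_weight x s e) * rho ^+ size (family_vertices phi).
  rewrite /family_edges big_flatten big_map big_enum /=.
  rewrite size_flatten /shape -map_comp sumnE big_map big_enum /= expr_sum -big_split /=.
  apply: eq_bigr => u _; move: (sup u); rewrite /branch_weight.
  by case: (phi u) => [t|] /= => [->|_]; rewrite ?mul1r// big_nil expr0 mulr1.
set A := \prod_(e <- _) _; have A0 : 0 <= A.
  by apply: prodr_ge0 => e _; exact: step_weight_ge0.
rewrite exprMn -exprM [leLHS]mulrA [leLHS]mulrC ler_wpM2r ?mulr_ge0 ?exprn_ge0//.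
exact: ler_wiXn2l.
Qed.

(** A family is a function of the vertex, so its sum factorises, with a factor at most 2 per spine
    vertex and at most 1 elsewhere. There are [n ^ m.+1] candidate spines, and all but one of these
    factors n join the edge factors [3 * p]. *)
Lemma expected_structure_sum m :
  \sum_x \sum_(s : m.-tuple 'I_n) \sum_phi \sum_om
    config_weight p q om * structure_weight x s phi om <=
  n%:R * (3 * (n%:R * p)) ^+ m * (2 * sig) ^+ m.+1.
Proof.
have B x (s : m.-tuple 'I_n) : \sum_phi \sum_om config_weight p q om * structure_weight x s phi om <=
    (3 * p) ^+ m * (2 * sig) ^+ m.+1.
  have R0 : 0 <= (3 * p) ^+ m * (2 * sig) ^+ m.+1.
    by rewrite mulr_ge0// exprn_ge0// mulr_ge0.
  apply: (le_trans (ler_sum _ (fun phi _ => expected_structure_weight x s phi))).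
  case: (boolP (uniq (x :: s))) => us; last by rewrite big1// => phi _; rewrite mul0r.
  under eq_bigr do rewrite mul1r.
  rewrite -big_distrr /= -(bigA_distr_bigA (branch_weight x s)) size_tuple [(2 * sig) ^+ _]exprMn.
  rewrite [2 ^+ _ * _]mulrC mulrA ler_wpM2l ?mulr_ge0 ?exprn_ge0 ?mulr_ge0//.
  apply: (@le_trans _ _ (\prod_u (if u \in x :: s then 2 else 1))).
    apply: ler_prod => u _; rewrite sum_branch_weight// andbT.
    by apply: sumr_ge0 => o _; exact: branch_weight_ge0.
  rewrite -(prod_mem_if (fun=> 2) us) big_const_seq count_predT.
  by rewrite -Monoid.iteropE [size _]/= size_tuple.
apply: (@le_trans _ _ (\sum_(x < n) \sum_(s : m.-tuple 'I_n) (3 * p) ^+ m * (2 * sig) ^+ m.+1)).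
  by apply: ler_sum => x _; apply: ler_sum => s _.
rewrite !sumr_const card_tuple card_ord -!mulrnA -[leLHS]mulr_natl.
rewrite mulnC natrM natrX !exprMn le_eqVlt; apply/orP; left; apply/eqP; ring.
Qed.

End Structures.

(** * From a path without block vertices to a structure *)

Lemma uniq_flatten_map (I : eqType) (T : eqType) (l : seq I) (f : I -> seq T) :
  uniq l -> {in l, forall u, uniq (f u)} ->
  {in l &, forall u v, u != v -> forall z, z \in f u -> z \notin f v} ->
  uniq (flatten [seq f u | u <- l]).
Proof.
elim: l => //= u l IH /andP[ul ll] uf dis; rewrite cat_uniq uf ?mem_head//=.
rewrite IH//; last 2 first.
- by move=> v vl; apply: uf; rewrite inE vl orbT.
- by move=> v v' vl vl'; apply: dis; rewrite inE ?vl ?vl' orbT.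
rewrite andbT; apply/hasPn => z /flatten_mapP[v vl zv].
apply: (dis v u) => //; rewrite ?inE ?vl ?eqxx ?orbT//.
by apply: contraNneq ul => <-.
Qed.

Lemma exists_family (n : nat) (D : {set 'I_n}) (Q : 'I_n -> seq 'I_n) :
  {in D, forall u, uniq (u :: Q u)} ->
  exists phi : {ffun 'I_n -> branch n},
    forall u, if u \in D then branch_vertices u (phi u) = u :: Q u else phi u = None.
Proof.
move=> uQ; suff /choice[f fP] : forall u, exists o : branch n,
    if u \in D then branch_vertices u o = u :: Q u else o = None.
  by exists [ffun u => f u] => u; rewrite ffunE; exact: fP.
move=> u; case: (boolP (u \in D)) => uD; last by exists None.
have sz : (size (Q u) < n)%N.
  rewrite -[ltnRHS](card_ord n) -[X in (X <= _)%N]/(size (u :: Q u)).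
  by rewrite -(card_uniqP (uQ u uD)); exact: max_card.
by exists (Some (Tagged (fun k : 'I_n => k.-tuple 'I_n)
   (in_tuple (Q u) : (Ordinal sz).-tuple 'I_n))).
Qed.

Section BadStructure.
Variables (R : realType) (n : nat) (X : {set 'I_n} -> bool) (Gam : {set 'I_n} -> R) (d eps : R).
Let E : rel 'I_n := fun u v => (u != v) && X [set u; v]%SET.

Lemma admissible_family x p (D : {set 'I_n}) (Q : 'I_n -> seq 'I_n) :
  gpath E x p -> {subset D <= x :: p} ->
  {in D, forall u, gpath E u (Q u) /\ 1 <= pweight E Gam d eps u (Q u)} ->
  {in D &, forall u v, u != v -> forall z, z \in u :: Q u -> z \notin v :: Q v} ->
  (size p < \sum_(u in D) 4 * (size (Q u)).+1)%N ->
  exists phi, [/\ admissible x p phi, all X (edges (x :: p) ++ family_edges phi) &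
    1 <= \prod_(v <- family_vertices phi) vweight E Gam d eps v].
Proof.
move=> Gp Dp HQ dis K.
have [|phi phiP] := @exists_family n D Q.
  by move=> u uD; have [/andP[_]] := HQ u uD.
have bvD u : u \in D -> branch_vertices u (phi u) = u :: Q u.
  by move=> uD; move: (phiP u); rewrite uD.
have bvN u : u \notin D -> phi u = None.
  by move=> uD; move: (phiP u); rewrite (negbTE uD).
exists phi; split.
- apply/and4P; split; first by case/andP: Gp.
  + apply: uniq_flatten_map; first exact: enum_uniq.
      move=> u _; case: (boolP (u \in D)) => uD; last by rewrite bvN.
      by rewrite bvD//; have [/andP[_]] := HQ u uD.
    move=> u v _ _ uv z; case: (boolP (u \in D)) => uD; last by rewrite bvN.
    case: (boolP (v \in D)) => vD; last by rewrite (bvN v vD).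
    by rewrite !bvD//; exact: dis.
  + apply/forallP => u; apply/implyP; case: (boolP (u \in D)) => [/Dp//|/bvN ->].
    by rewrite eqxx.
  + apply: (leq_trans K); rewrite size_flatten /shape -map_comp sumnE big_map big_enum /=.
    rewrite big_distrr big_mkcond /=; apply: leq_sum => u _.
    by case: ifP => // uD; rewrite bvD.
- rewrite all_cat; apply/andP; split.
    by case/andP: Gp => /path_edges.
  apply/allP => e /flatten_mapP[u _]; case: (boolP (u \in D)) => uD; last by rewrite bvN.
  rewrite bvD// => ee; have [/andP[/path_edges /allP h _] _] := HQ u uD.
  exact: h.
- rewrite /family_vertices big_flatten big_map big_enum /=.
  apply: (big_ind (fun y : R => 1 <= y)) => // [y z hy hz|u _]; first exact: mulr_ege1.
  case: (boolP (u \in D)) => uD; last by rewrite bvN// big_nil.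
  by rewrite bvD//; have [_] := HQ u uD.
Qed.

Lemma bad_structure (r : R) x p : 0 <= r ->
  locally_simple_paths E r r (x, p) ->
  ~ (exists2 u, u \in x :: p & block_vertex E Gam d eps u) ->
  exists y s phi, [/\ r <= (size s)%:R, admissible y s phi,
    all X (edges (y :: s) ++ family_edges phi) &
    1 <= \prod_(v <- family_vertices phi) vweight E Gam d eps v].
Proof.
move=> r0 [/= Gp ls rp] nb.
have Esym : symmetric E by move=> u v; rewrite /E eq_sym finset.setUC.
have /choice[Q HQ] : forall u, exists q, u \in x :: p ->
    gpath E u q /\ 1 <= pweight E Gam d eps u q.
  move=> u; case: (boolP (u \in x :: p)) => up; last by exists [::].
  have : ~ block_vertex E Gam d eps u by move=> bu; apply: nb; exists u.
  move=> /existsNP[q /not_implyP[Gq /not_implyP[_ /negP]]]; rewrite -leNgt => h.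
  by exists q.
(* A long path of weight at least 1 serves both as spine and as its only branch. Here all edges of
   the branch repeat edges of the spine. *)
case: (pselect (exists2 u, u \in x :: p & r <= (size (Q u))%:R)) => [[u up ru]|nlong].
  have [Gu wu] := HQ u up.
  have [||||phi [h1 h2 h3]] := @admissible_family u (Q u) [set u]%SET Q Gu.
  - by move=> v /set1P ->; rewrite mem_head.
  - by move=> v /set1P ->.
  - by move=> v v' /set1P -> /set1P ->; rewrite eqxx.
  - by rewrite big_set1; exact: leq_pmull.
  by exists u, (Q u), phi.
have short u : u \in x :: p -> gpath E u (Q u) /\ (size (Q u))%:R <= r.
  move=> up; split; first by case: (HQ u up).
  by rewrite leNgt; apply/negP => /ltW h; apply: nlong; exists u.
have [D [Dp dis K]] := locally_simple_disjoint_family Esym r0 Gp ls short.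
have [|phi [h1 h2 h3]] := @admissible_family x p D Q Gp Dp _ dis K.
  by move=> u /Dp; exact: HQ.
by exists x, p, phi.
Qed.

Lemma aggregate_influence_le (N : nat) (g : 'I_N.+1 -> R)
    (om : {ffun {set 'I_n} -> bool * 'I_N.+1}) u :
  (forall e : {set 'I_n}, #|e| = 2%N ->
     [/\ (om e).1 = X e, 0 <= Gam e & Gam e <= g (om e).2]) ->
  aggregate_influence E Gam u <= config_influence g om u.
Proof.
move=> H; rewrite /aggregate_influence /config_influence.
have -> : \sum_(w | E u w) Gam [set u; w]%SET =
    \sum_(e in [set [set u; w]%SET | w in [set w | E u w]%SET]%SET) Gam e.
  rewrite big_imset /=; first by apply: eq_bigl => w; rewrite inE.
  move=> v w; rewrite !inE => /andP[uv _] _ /eq_set2.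
  by rewrite eqxx /= => /orP[/eqP//|/andP[_ /eqP vu]]; rewrite vu eqxx in uv.
rewrite big_mkcond [leRHS]big_mkcond /=; apply: ler_sum => e _; case: ifP => [|_].
  move=> /imsetP[w]; rewrite inE => /andP[uw Xuw] ->.
  have c2 : #|[set u; w]%SET| = 2%N by rewrite cards2 uw.
  by rewrite c2 set21 /=; have [-> _ h] := H _ c2; rewrite Xuw mul1r.
case: ifP => // /andP[/eqP c2 _]; have [_ G0 G1] := H _ c2.
by rewrite mulr_ge0//; exact: le_trans G1.
Qed.

End BadStructure.

(** A light vertex is covered by the first term. For a heavy one, [A <= expR (A - 1)] and
    [s * (A - 1) <= tau * (A - 1 + eps / 2)]: if [A <= 1] the left side is nonpositive and the right
    side nonnegative, otherwise [s <= tau] suffices. Monotonicity in A lets the rounded value [At]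
    enter. *)
Lemma vweight_pow_le (R : realType) (A At d eps tau : R) (s : nat) :
  0 < eps -> eps < 1 -> 0 <= d -> A <= At -> s%:R <= tau ->
  (if A <= 1 - eps / 2 then 1 - eps / 4 else d * A) ^+ s <=
  (1 - eps / 4) ^+ s + d ^+ s * expR (- (tau * (1 - eps / 2))) * expR (tau * At).
Proof.
move=> e0 e1 d0 AAt st; have s0 : 0 <= s%:R :> R by [].
case: ifPn => [_|hA].
  by rewrite lerDl !mulr_ge0 ?exprn_ge0 ?expR_ge0.
rewrite -ltNge in hA.
apply: (@le_trans _ _ (d ^+ s * expR (- (tau * (1 - eps / 2))) * expR (tau * At))); last first.
  by rewrite lerDr exprn_ge0//; lra.
rewrite exprMn -mulrA -expRD ler_wpM2l ?exprn_ge0//.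
apply: (@le_trans _ _ (expR (s%:R * (A - 1)))).
  rewrite expRM_natl; apply: lerXn2r; rewrite ?nnegrE ?expR_ge0//; first lra.
  by have := expR_ge1Dx (A - 1); rewrite addrCA subrr addr0.
rewrite ler_expR.
have : s%:R * (A - 1) <= tau * (A - (1 - eps / 2)).
  case: (leP A 1) => h1; last by apply: ler_pM => //; lra.
  have : 0 <= tau * (A - (1 - eps / 2)) by rewrite mulr_ge0//; lra.
  have : 0 <= s%:R * (1 - A) by rewrite mulr_ge0//; lra.
  lra.
have : tau * A <= tau * At by rewrite ler_wpM2l//; lra.
lra.
Qed.

(** * The exponential moment of the absolute value of a Gaussian *)

Section GaussianMoment.
Variable R : realType.
Local Notation mu := (@lebesgue_measure R).
Local Notation phi := (normal_pdf (0 : R) 1).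

Lemma std_normal_pdfE (x : R) : phi x = normal_peak 1 * expR (- (x ^+ 2 / 2)).
Proof.
by rewrite normal_pdfE ?oner_neq0// /normal_fun subr0 expr1n -mulr_natl mulr1 mulNr.
Qed.

Lemma std_normal_pdfN (x : R) : phi (- x) = phi x.
Proof. by rewrite !std_normal_pdfE sqrrN. Qed.

Lemma std_normal_half : normal_prob (0 : R) 1 `[0, +oo[ = (2^-1)%:E.
Proof.
have := @integral_normal_pdf R 0 1.
rewrite ge0_symfun_integralT; last 3 first.
- by move=> x; exact: normal_pdf_ge0.
- exact: continuous_normal_pdf (oner_neq0 _).
- by move=> x /=; rewrite std_normal_pdfN.
have -> : [set x : R | 0 <= x] = `[0, +oo[%classic.
  by apply/seteqP; split => x /=; rewrite in_itv /= andbT.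
rewrite -/(normal_prob 0 1 `[0, +oo[).
have : normal_prob (0 : R) 1 `[0, +oo[ \is a fin_num.
  by apply: (@fin_num_measure _ _ _ (normal_prob (0 : R) 1)); exact: measurable_itv.
by case: (normal_prob _ _ _) => // y _ [h]; congr (_%:E); lra.
Qed.

(** Half the mass lies on the positive axis, and on an interval of length [al] the density is at
    most its peak. *)
Lemma std_normal_tail (al : R) : 0 <= al ->
  (normal_prob (0 : R) 1 `[(- al)%R, +oo[ <= (2^-1 + al * normal_peak 1)%:E)%E.
Proof.
move=> al0.
have -> : `[(- al)%R, +oo[%classic = `[(- al)%R, 0%R[%classic `|` `[0%R, +oo[%classic :> set R.
  by rewrite -itv_bndbnd_setU// bnd_simp; rewrite oppr_le0.
have U : (normal_prob (0 : R) 1 (`[(- al)%R, 0%R[ `|` `[0%R, +oo[) <=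
    normal_prob (0 : R) 1 `[(- al)%R, 0%R[ + normal_prob (0 : R) 1 `[0%R, +oo[)%E.
  by apply: (@measureU2 _ _ _ (normal_prob (0 : R) 1)); exact: measurable_itv.
apply: (le_trans U).
rewrite std_normal_half addeC EFinD leeD2l//.
apply: (@le_trans _ _ (\int[mu]_(x in `[(- al)%R, 0%R[) (normal_peak 1)%:E))%E.
  apply: ge0_le_integral => //=.
  - by move=> x _; rewrite lee_fin normal_pdf_ge0.
  - by apply/measurable_EFinP/measurable_funTS; exact: measurable_normal_pdf.
  - by move=> x _; rewrite lee_fin; apply: normal_pdf_ub; exact: oner_neq0.
rewrite integral_cst//= lebesgue_measure_itv /= lte_fin oppr_lt0.
case: ifP => _; last by rewrite mule0 lee_fin mulr_ge0// normal_peak_ge0.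
by rewrite add0e opprK -EFinM mulrC.
Qed.

Lemma std_normal_shift (al : R) :
  (\int[mu]_(x in `[0%R, +oo[) (phi (x - al)%R)%:E = normal_prob (0 : R) 1 `[(- al)%R, +oo[)%E.
Proof.
pose F (x : R) : R := x - al.
have dF (x : R) : is_derive x (1 : R) F 1.
  have := is_deriveB (is_derive_id x (1 : R)) (is_derive_cst al x (1 : R)).
  by rewrite subr0.
have F' : (F^`())%classic = cst 1.
  by apply/funext => x; rewrite derive1E; have [_ ->] := dF x.
have cF : continuous F.
  by move=> x; apply: differentiable_continuous; apply/derivable1_diffP; have [] := dF x.
have F0 : - al = F 0 by rewrite /F sub0r.
rewrite /normal_prob [in RHS]F0.
rewrite (increasing_ge0_integration_by_substitutiony (F := F)).
- by apply: eq_integral => x _; rewrite F' /= !fctE mulr1.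
- by move=> x y _ _ xy; rewrite /F ltrD2r.
- by rewrite F' => x _; exact: cvg_cst.
- by rewrite F'; exact: is_cvg_cst.
- by rewrite F'; exact: is_cvg_cst.
- split; first by move=> x _; have [] := dF x.
  by apply: cvg_at_right_filter; exact: cF.
- exact: cvg_addrr.
- by apply: continuous_subspaceT; exact: continuous_normal_pdf (oner_neq0 _).
- by move=> x _; exact: normal_pdf_ge0.
Qed.

(** By symmetry this is twice the integral over the positive axis. Completing the square there
    shifts the density by [al] and leaves the factor [expR (al ^+ 2 / 2)]. *)
Lemma normal_exp_abs_moment (al : R) : 0 <= al ->
  (\int[mu]_x (expR (al * `|x|) * phi x)%:E <=
    (expR (al ^+ 2 / 2) * (1 + 2 * (al * normal_peak 1)))%:E)%E.
Proof.
move=> al0; rewrite (@ge0_symfun_integralT _ (fun x => expR (al * `|x|) * phi x)); last 3 first.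
- by move=> x; rewrite mulr_ge0 ?expR_ge0 ?normal_pdf_ge0.
- move=> x; apply: cvgM; last exact: continuous_normal_pdf (oner_neq0 _) _.
  apply: continuous_comp; last exact: continuous_expR.
  by apply: cvgMr; exact: norm_continuous.
- by move=> x /=; rewrite normrN std_normal_pdfN.
have -> : [set x : R | 0 <= x] = `[0, +oo[%classic.
  by apply/seteqP; split => x /=; rewrite in_itv /= andbT.
have -> : (\int[mu]_(x in `[0%R, +oo[) (expR (al * `|x|) * phi x)%:E =
    \int[mu]_(x in `[0%R, +oo[) ((expR (al ^+ 2 / 2))%:E * (phi (x - al)%R)%:E))%E.
  apply: eq_integral => x; rewrite inE /= in_itv /= andbT => x0; rewrite -EFinM; congr EFin.
  rewrite ger0_norm// !std_normal_pdfE mulrCA [RHS]mulrCA -!expRD; congr (_ * expR _).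
  by field.
rewrite ge0_integralZl//=; last 2 first.
- apply/measurable_EFinP/measurable_funTS/measurableT_comp; first exact: measurable_normal_pdf.
  exact: measurable_funB.
- by move=> x _; rewrite lee_fin normal_pdf_ge0.
rewrite std_normal_shift.
have T := std_normal_tail al0.
apply: (@le_trans _ _ (2%:E * ((expR (al ^+ 2 / 2))%:E * (2^-1 + al * normal_peak 1)%:E))%E).
  by rewrite lee_wpmul2l// lee_wpmul2l// lee_fin expR_ge0.
rewrite -!EFinM lee_fin le_eqVlt; apply/orP; left; apply/eqP; by field.
Qed.

End GaussianMoment.

(** * Influences and their rounding *)

(** This is [tanh (y/2) <= y/2]. The difference of the two sides has derivative
    [1 + (x - 1) * expR x], nonnegative because [1 - x <= expR (- x)]. *)
Lemma expR_sinh_le (R : realType) (y : R) : 0 <= y ->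
  2 * (expR y - 1) <= y * (expR y + 1).
Proof.
move=> y0; pose f (x : R) : R := x * (expR x + 1) - 2 * (expR x - 1).
have df (x : R) : is_derive x (1 : R) f (1 + (x - 1) * expR x).
  rewrite /f; apply: is_derive_eq.
  by rewrite addr0 subr0 -![_ *: _]/(_ * _); ring.
suff : f 0 <= f y by rewrite /f expR0; lra.
apply: (@ger0_derive1_ndecry _ f 0); [| | |exact: lexx|exact: y0].
- by move=> x _; have [] := df x.
- move=> x _; rewrite derive1E; have [_ ->] := df x.
  have h : 1 - x <= expR (- x) by have := expR_ge1Dx (- x).
  have : (1 - x) * expR x <= expR (- x) * expR x by rewrite ler_wpM2r ?expR_ge0.
  by rewrite -expRD addNr expR0; lra.
- apply: continuous_subspaceT => x; apply: differentiable_continuous.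
  by apply/derivable1_diffP; have [] := df x.
Qed.

Section Influence.
Variables (R : realType) (beta : R).

Lemma influence_ge0 x : 0 <= influence beta x.
Proof. by rewrite divr_ge0// addr_ge0// expR_ge0. Qed.

Lemma influence_lt1 x : influence beta x < 1.
Proof.
have e0 := expR_gt0 (beta * x).
rewrite ltr_pdivrMr ?mul1r; last by rewrite addr_gt0.
by rewrite ltr_norml; apply/andP; split; lra.
Qed.

(** The influence is [|tanh (beta * x / 2)|]. *)
Lemma influence_le x : 0 <= beta -> influence beta x <= beta * `|x| / 2.
Proof.
move=> b0; have -> : beta * `|x| = `|beta * x| by rewrite normrM (ger0_norm b0).
rewrite /influence; move: (beta * x) => y.
have e0 := expR_gt0 y; rewrite ler_pdivrMr; last by rewrite addr_gt0.
have [y0|y0] := leP 0 y.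
  have := expR_sinh_le y0; have : 1 <= expR y by rewrite -expR0 ler_expR.
  move=> e1; rewrite (ger0_norm y0) ler0_norm; lra.
have Ny : 0 <= - y by lra.
have := expR_sinh_le Ny; have e1 : expR y <= 1 by rewrite -expR0 ler_expR ltW.
rewrite (ltr0_norm y0) ger0_norm; last lra.
move=> h; have : 2 * (expR (- y) - 1) * expR y <= - y * (expR (- y) + 1) * expR y.
  by rewrite ler_wpM2r// ltW.
have : expR (- y) * expR y = 1 by rewrite -expRD addNr expR0.
by move: (expR (- y)) (expR y) => u v uv; nra.
Qed.

Lemma continuous_influence : continuous (influence beta).
Proof.
have ce (x : R) : {for x, continuous (fun y => expR (beta * y))}.
  apply: continuous_comp; last exact: continuous_expR.
  by apply: cvgMr; exact: cvg_id.
move=> x; apply: cvgM.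
  by apply: cvg_norm; apply: cvgB; [exact: cvg_cst|exact: ce].
apply: cvgV; first by rewrite gt_eqF// addr_gt0// expR_gt0.
by apply: cvgD; [exact: cvg_cst|exact: ce].
Qed.

Lemma measurable_influence : measurable_fun setT (influence beta).
Proof. by apply: continuous_measurable_fun; exact: continuous_influence. Qed.

Variable N : nat.

(** Influences lie in [0, 1), so [inord] never falls back to its default value. The value attached
    to a bucket is its upper end, so that rounding only increases influences. *)
Definition bucket (x : R) : 'I_N.+1 := inord (Num.truncn (N.+1%:R * influence beta x)).

Definition bucket_value (j : 'I_N.+1) : R := j.+1%:R / N.+1%:R.

Lemma bucketE x : bucket x = Num.truncn (N.+1%:R * influence beta x) :> nat.
Proof.
rewrite /bucket inordK// truncn_lt_nat ?mulr_ge0 ?influence_ge0//.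
by rewrite gtr_pMr// influence_lt1.
Qed.

Lemma influence_le_bucket x : influence beta x <= bucket_value (bucket x).
Proof.
rewrite /bucket_value bucketE ler_pdivlMr// mulrC.
by have := truncnS_gt (N.+1%:R * influence beta x) => /ltW.
Qed.

Lemma bucket_value_le x : bucket_value (bucket x) <= influence beta x + N.+1%:R^-1.
Proof.
rewrite /bucket_value bucketE ler_pdivrMr// mulrDl mulVf ?pnatr_eq0//.
rewrite -natr1 lerD2r mulrC truncn_le mulr_ge0// influence_ge0//.
Qed.

Lemma bucket_value_linear (lam x : R) : 0 <= beta -> 0 <= lam ->
  lam * bucket_value (bucket x) <= lam / N.+1%:R + lam * beta / 2 * `|x|.
Proof.
move=> b0 lam0; have h1 := bucket_value_le x; have h2 := influence_le x b0.
have : lam * bucket_value (bucket x) <= lam * (beta * `|x| / 2 + N.+1%:R^-1).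
  by rewrite ler_wpM2l//; apply: (le_trans h1); rewrite lerD2r.
by move: (N.+1%:R^-1) => k h; apply: (le_trans h); lra.
Qed.

Lemma measurable_bucket (j : 'I_N.+1) : measurable [set x | bucket x = j].
Proof.
have -> : [set x | bucket x = j] = (fun x => N.+1%:R * influence beta x) @^-1` `[j%:R, j.+1%:R[.
  apply/seteqP; split => x /=; rewrite in_itv /= -truncn_eq ?mulr_ge0 ?influence_ge0//.
    by move=> <-; rewrite -bucketE.
  by rewrite -bucketE => /eqP h; apply: val_inj.
rewrite -[X in measurable X]setTI.
have mf : measurable_fun setT (fun x => N.+1%:R * influence beta x).
  by apply: measurable_funM => //; exact: measurable_influence.
exact: mf.
Qed.

Definition bucket_prob (j : 'I_N.+1) : R := fine (normal_prob (0 : R) 1 [set x | bucket x = j]).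

Lemma bucket_probE j : (bucket_prob j)%:E = normal_prob (0 : R) 1 [set x | bucket x = j].
Proof.
rewrite /bucket_prob fineK//.
by apply: (@fin_num_measure _ _ _ (normal_prob (0 : R) 1)); exact: measurable_bucket.
Qed.

Lemma bucket_prob_ge0 j : 0 <= bucket_prob j.
Proof.
rewrite -lee_fin bucket_probE.
exact: (@measure_ge0 _ _ _ (normal_prob (0 : R) 1)).
Qed.

(** Rounding costs at most [1 / N.+1] and the influence is at most [beta * |x| / 2]. As the buckets
    are disjoint, the sum is bounded by a Gaussian integral of [expR (al * |x|)] over the whole
    line. *)
Lemma bucket_moment (lam : R) : 0 <= beta -> 0 <= lam ->
  \sum_j bucket_prob j * expR (lam * bucket_value j) <=
  expR (lam / N.+1%:R) * (expR ((lam * beta / 2) ^+ 2 / 2) *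
    (1 + lam * beta * normal_peak 1)).
Proof.
move=> b0 lam0; set al := lam * beta / 2.
have al0 : 0 <= al by rewrite !mulr_ge0.
have M := normal_exp_abs_moment al0.
have -> : lam * beta * normal_peak 1 = 2 * (al * normal_peak 1) by rewrite /al; field.
set C := expR (lam / N.+1%:R).
pose f (x : R) : \bar R := (C%:E * (expR (al * `|x|) * normal_pdf 0 1 x)%:E)%E.
have mE : measurable_fun setT (fun x : R => (expR (al * `|x|) * normal_pdf 0 1 x)%:E).
  apply/measurable_EFinP/measurable_funM; last exact: measurable_normal_pdf.
  by apply: measurableT_comp => //; apply: measurable_funM => //; exact: measurableT_comp.
have mf : measurable_fun setT f by apply: emeasurable_funM => //.
have f0 x : (0 <= f x)%E.
  by rewrite mule_ge0// lee_fin ?expR_ge0// mulr_ge0 ?expR_ge0 ?normal_pdf_ge0.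
rewrite -lee_fin -sumEFin.
apply: (@le_trans _ _ (\sum_j \int[lebesgue_measure]_(x in [set x | bucket x = j]) f x)%E).
  apply: lee_sum => j _; rewrite EFinM bucket_probE muleC /normal_prob.
  have mB := measurable_bucket j.
  rewrite -ge0_integralZl//=; last 2 first.
  - by apply/measurable_EFinP/measurable_funTS; exact: measurable_normal_pdf.
  - by move=> x _; rewrite lee_fin normal_pdf_ge0.
  apply: ge0_le_integral => //=.
  - by move=> x _; rewrite mule_ge0// lee_fin ?expR_ge0// normal_pdf_ge0.
  - apply/measurable_funTS/emeasurable_funM => //.
    by apply/measurable_EFinP; exact: measurable_normal_pdf.
  - exact: measurable_funTS.
  - move=> x <-; rewrite /f -!EFinM lee_fin [leRHS]mulrA ler_wpM2r ?normal_pdf_ge0//.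
    rewrite /C -expRD ler_expR.
    exact: bucket_value_linear.
pose B (j : 'I_N.+1) := [set x | bucket x = j].
have tB : trivIset [set` index_enum 'I_N.+1] B.
  by apply/trivIsetP => i j _ _ ij; rewrite -subset0 => x [/= xi xj]; move: ij; rewrite -xi -xj eqxx.
have mU : measurable (\big[setU/set0]_(j <- index_enum 'I_N.+1) B j).
  by apply: bigsetU_measurable => j _; exact: measurable_bucket.
rewrite -(@ge0_integral_bigsetU _ _ _ lebesgue_measure _ B f (index_enum 'I_N.+1)); last 5 first.
- by move=> j; exact: measurable_bucket.
- exact: index_enum_uniq.
- exact: tB.
- exact: measurable_funTS.
- by [].
apply: (@le_trans _ _ (\int[lebesgue_measure]_x f x)%E).
  by apply: ge0_subset_integral.
rewrite /f ge0_integralZl//=; last 2 first.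
- by move=> x _; rewrite lee_fin mulr_ge0 ?expR_ge0 ?normal_pdf_ge0.
- by rewrite lee_fin expR_ge0.
by rewrite EFinM lee_wpmul2l// lee_fin expR_ge0.
Qed.

End Influence.

(** * The law of the rounded configuration *)

Section Discretization.
Variables (disp : measure_display) (T : measurableType disp) (R : realType).
Variables (P : probability T R) (n : nat).
Variables (X : {set 'I_n} -> {RV P >-> bool}) (J : {set 'I_n} -> {RV P >-> R}).
Variables (p beta : R) (N : nat).

(** The constant value off the pairs is the point mass of [edge_weight]. *)
Definition discretize (w : T) : {ffun {set 'I_n} -> bool * 'I_N.+1} :=
  [ffun e : {set 'I_n} => if #|e| == 2%N then (X e w : bool, bucket beta N (J e w))
                          else (false, ord0)].

Definition edge_event (om : {ffun {set 'I_n} -> bool * 'I_N.+1})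
    (i : {set 'I_n} + {set 'I_n}) : set T :=
  match i with
  | inl e => X e @^-1` [set (om e).1]
  | inr e => J e @^-1` [set x | bucket beta N x = (om e).2]
  end.

Lemma generated_edge_event om i : generated_events X J i (edge_event om i).
Proof.
case: i => e /=; first by exists [set (om e).1] => //; rewrite setTI.
exists [set x | bucket beta N x = (om e).2]; last by rewrite setTI.
exact: measurable_bucket.
Qed.

Lemma measurable_edge_event om i : measurable (edge_event om i).
Proof.
case: i => e /=; rewrite -[X in measurable X]setTI.
  have mX : measurable_fun setT (X e) by exact: measurable_funPT.
  exact: mX.
have mJ : measurable_fun setT (J e) by exact: measurable_funPT.
by apply: mJ => //; exact: measurable_bucket.
Qed.

Lemma discretize_eqE (om : {ffun {set 'I_n} -> bool * 'I_N.+1}) :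
  (forall e : {set 'I_n}, #|e| <> 2%N -> om e = (false, ord0)) ->
  [set w | discretize w = om] = \bigcap_(i in [set` edge_variables n]) edge_event om i.
Proof.
move=> om2; apply/seteqP; split => w /=.
  by move=> <- [] e /=; rewrite inE => /eqP e2; rewrite ffunE e2.
move=> H; apply/ffunP => e; rewrite ffunE; case: eqP => [e2|/om2 ->//].
have := H (inl e); have := H (inr e); rewrite /= !inE e2 eqxx => -> // -> //.
by case: (om e).
Qed.

Lemma discretize_eq0 (om : {ffun {set 'I_n} -> bool * 'I_N.+1}) (e : {set 'I_n}) :
  #|e| <> 2%N -> om e <> (false, ord0) ->
  [set w | discretize w = om] = set0.
Proof.
move=> /eqP /negbTE e2 ome; rewrite -subset0 => w /= E; apply: ome.
by rewrite -E ffunE e2.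
Qed.

Lemma measurable_discretize om : measurable [set w | discretize w = om].
Proof.
case: (pselect (forall e : {set 'I_n}, #|e| <> 2%N -> om e = (false, ord0))) => [H|].
  rewrite discretize_eqE//; apply: fin_bigcap_measurable => [|i _].
    exact: finite_finset.
  exact: measurable_edge_event.
move=> /existsNP[e /not_implyP[e2 ome]]; rewrite (discretize_eq0 e2 ome).
exact: measurable0.
Qed.

Hypothesis EA : edwards_anderson X J p.

Lemma discretize_law om :
  P [set w | discretize w = om] = (config_weight p (bucket_prob beta (N := N)) om)%:E.
Proof.
case: EA => HX HJ ind.
case: (pselect (forall e : {set 'I_n}, #|e| <> 2%N -> om e = (false, ord0))) => [H|]; last first.
  move=> /existsNP[e /not_implyP[e2 ome]]; rewrite (discretize_eq0 e2 ome) measure0.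
  rewrite /config_weight (bigD1 e)//= /edge_weight; case: eqP => // _.
  by case: eqP => // _; rewrite mul0r.
rewrite discretize_eqE// ind//; last by move=> i _; exact: generated_edge_event.
rewrite big_sumType /= /config_weight.
have PX (e : {set 'I_n}) : #|e| = 2%N ->
    P (edge_event om (inl e)) = (if (om e).1 then p else 1 - p)%:E.
  move=> e2 /=; case: (om e).1; first exact: HX.
  have -> : X e @^-1` [set false] = ~` (X e @^-1` [set true]).
    by apply/seteqP; split => w /=; case: (X e w).
  rewrite probability_setC ?HX//.
  have mX : measurable_fun setT (X e) by exact: measurable_funPT.
  by rewrite -[X in measurable X]setTI; exact: mX.
have PJ (e : {set 'I_n}) : #|e| = 2%N ->
    P (edge_event om (inr e)) = (bucket_prob beta (om e).2)%:E.
  move=> e2; rewrite bucket_probE -(HJ e e2)//; exact: measurable_bucket.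
have -> : (\prod_(i | inl i \in edge_variables n) P (edge_event om (inl i)) =
    \prod_(e : {set 'I_n} | #|e| == 2%N) (if (om e).1 then p else 1 - p)%:E)%E.
  by apply: eq_big => [e|e]; rewrite inE// => /eqP; exact: PX.
have -> : (\prod_(i | inr i \in edge_variables n) P (edge_event om (inr i)) =
    \prod_(e : {set 'I_n} | #|e| == 2%N) (bucket_prob beta (om e).2)%:E)%E.
  by apply: eq_big => [e|e]; rewrite inE// => /eqP; exact: PJ.
rewrite !prodEFin -EFinM -big_split; congr (_%:E).
rewrite big_mkcond; apply: eq_bigr => e _; rewrite /edge_weight.
by case: ifPn => // /eqP /H ->; rewrite eqxx.
Qed.

(** Markov's inequality: [A] is covered by the configurations on which [Z >= 1]. *)
Lemma prob_le_config_sum (A : set T) (Z : {ffun {set 'I_n} -> bool * 'I_N.+1} -> R) :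
  measurable A -> (forall om, 0 <= Z om) -> (forall w, A w -> 1 <= Z (discretize w)) ->
  (P A <= (\sum_om config_weight p (bucket_prob beta (N := N)) om * Z om)%:E)%E.
Proof.
move=> mA Z0 ZA.
have w0 (om : {ffun {set 'I_n} -> bool * 'I_N.+1}) : 0 <= config_weight p (bucket_prob beta (N := N)) om.
  by rewrite -lee_fin -discretize_law measure_ge0.
pose r := [seq om <- enum {ffun {set 'I_n} -> bool * 'I_N.+1} | 1 <= Z om].
have ur : uniq r by rewrite filter_uniq// enum_uniq.
apply: (@le_trans _ _ (\sum_(om \in [set` r]) P [set w | discretize w = om])%E).
  apply: content_sub_fsum => //; first by move=> om _; exact: measurable_discretize.
  by move=> w Aw; exists (discretize w) => //=; rewrite mem_filter ZA// mem_enum.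
rewrite -fsbig_seq// big_filter big_enum_cond /=.
under eq_bigr do rewrite discretize_law.
rewrite sumEFin lee_fin big_mkcond; apply: ler_sum => om _.
case: ifP => [h|_]; last by rewrite mulr_ge0.
by rewrite -[leLHS]mulr1 ler_wpM2l.
Qed.

End Discretization.

(** * Measurability of the event *)

Lemma bigcup_countType_measurable (disp : measure_display) (T : measurableType disp)
    (I : countType) (D : set I) (F : I -> set T) :
  (forall i, D i -> measurable (F i)) -> measurable (\bigcup_(i in D) F i).
Proof.
move=> mF; rewrite bigcup_mkcond; apply: countable_bigcupT_measurable; first exact: countableP.
by move=> i; case: ifPn => [/set_mem /mF//|_]; exact: measurable0.
Qed.

Lemma bigcap_countType_measurable (disp : measure_display) (T : measurableType disp)
    (I : countType) (D : set I) (F : I -> set T) :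
  (forall i, D i -> measurable (F i)) -> measurable (\bigcap_(i in D) F i).
Proof.
move=> mF; rewrite -[X in measurable X]setCK setC_bigcap; apply: measurableC.
by apply: bigcup_countType_measurable => i /mF; exact: measurableC.
Qed.

Section BlockEvent.
Variables (disp : measure_display) (T : measurableType disp) (R : realType).
Variables (P : probability T R) (n : nat).
Variables (X : {set 'I_n} -> {RV P >-> bool}) (J : {set 'I_n} -> {RV P >-> R}).
Variables (beta d eps r : R).

Lemma measurable_pweight (E : rel 'I_n) u q :
  measurable_fun setT (fun w => pweight E (ea_influence J beta w) d eps u q).
Proof.
have mA v : measurable_fun setT (fun w => aggregate_influence E (ea_influence J beta w) v).
  rewrite /aggregate_influence; under eq_fun do rewrite -big_filter.
  apply: measurable_sum => y; apply: (measurableT_comp (measurable_influence beta)).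
  exact: measurable_funPT.
rewrite /pweight; apply: measurable_prod => v _.
apply: measurable_fun_ifT => //; last exact: measurable_funM.
exact: measurable_fun_ler.
Qed.

(** The graph takes finitely many values. Once it is fixed, the event is a countable combination of
    the events [pweight < 1], because pairs (head, tail) form a countable type. *)
Lemma measurable_block_event :
  measurable [set w | forall x p,
        locally_simple_paths (random_graph X w) r r (x, p) ->
        exists2 u, u \in x :: p &
          block_vertex (random_graph X w) (ea_influence J beta w) d eps u].
Proof.
set S := [set w | _].
pose G (g : {ffun {set 'I_n} -> bool}) : rel 'I_n := fun u v => (u != v) && g [set u; v]%SET.
pose B g u := \bigcap_(q in [set q | gpath (G g) u q /\ (size q)%:R <= ln (#|'I_n|%:R : R)])
  [set w | pweight (G g) (ea_influence J beta w) d eps u q < 1].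
pose S' g := \bigcap_(xp in locally_simple_paths (G g) r r)
  \bigcup_(u in [set u | u \in xp.1 :: xp.2]) B g u.
pose Eg (g : {ffun {set 'I_n} -> bool}) := \bigcap_(e in [set: {set 'I_n}]) (X e @^-1` [set g e]).
have -> : S = \bigcup_(g in [set: {ffun {set 'I_n} -> bool}]) (Eg g `&` S' g).
  have GX g w : Eg g w -> random_graph X w = G g.
    by move=> H; apply/funext => u; apply/funext => v; rewrite /random_graph /G (H [set u; v]%SET).
  have BE g w u : Eg g w -> B g u w <->
      block_vertex (random_graph X w) (ea_influence J beta w) d eps u.
    move=> /GX ->; split => [H q Gq sq|H q [Gq sq]]; first by apply: (H q).
    exact: H.
  apply/seteqP; split => w.
    move=> Sw; exists [ffun e => X e w : bool] => //.
    have Ew : Eg [ffun e => X e w : bool] w by move=> e _ /=; rewrite ffunE.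
    split => // -[x p] /=; rewrite -(GX _ _ Ew) => /Sw[u up bu].
    by exists u => //; apply/(BE _ _ _ Ew).
  move=> [g _ [Ew S'w]] x p; rewrite (GX _ _ Ew) => /S'w[/= u up /(BE _ _ _ Ew) bu].
  by exists u => //; rewrite -(GX _ _ Ew).
apply: bigcup_countType_measurable => g _; apply: measurableI.
  apply: bigcap_countType_measurable => e _; rewrite -[X in measurable X]setTI.
  have mX : measurable_fun setT (X e) by exact: measurable_funPT.
  exact: mX.
apply: bigcap_countType_measurable => xp _; apply: bigcup_countType_measurable => u _.
apply: bigcap_countType_measurable => q _.
have -> : [set w | pweight (G g) (ea_influence J beta w) d eps u q < 1] =
    (fun w => pweight (G g) (ea_influence J beta w) d eps u q) @^-1` `]-oo, 1[.
  by apply/seteqP; split => w /=; rewrite in_itv.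
by rewrite -[X in measurable X]setTI; apply: measurable_pweight.
Qed.

End BlockEvent.

(** * Numerical estimates and the origin of the constants *)

Lemma expR_le_1D2x (R : realType) (x : R) : 0 <= x -> x <= 2^-1 -> expR x <= 1 + 2 * x.
Proof.
move=> x0 x1; have h := expR_ge1Dx (- x).
have e0 := expR_gt0 x.
have : (1 - x) * expR x <= expR (- x) * expR x by rewrite ler_wpM2r// ltW.
rewrite -expRD addNr expR0; move: (expR x) e0 => z z0 hz; nra.
Qed.

(** The constant 96 is chosen here. With [th = eps / 96], rounding costs a factor
    [expR (2 * th ^+ 2)] and the Gaussian square [expR (4 * th ^+ 2)], together at most
    [1 + 12 * th ^+ 2]. Times a main factor of at most 2, the error is at most [24 * th ^+ 2], and
    [24 * th = eps / 4] degrades [1 - eps] to [1 - 3 * eps / 4] only. *)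
Lemma ea_edge_moment (R : realType) (eps d beta : R) (N c : nat) :
  0 < eps -> eps < 1 -> 1 <= d -> 0 < beta -> beta <= (1 - eps) * beta_c d ->
  d <= eps / 96 * N.+1%:R -> (c <= 2)%N ->
  \sum_j bucket_prob beta j * expR (eps / 96 * d * (c%:R * bucket_value R (N := N) j)) <=
  1 + c%:R * (eps / 96 * (1 - 3 * eps / 4)).
Proof.
move=> e0 e1 d1 b0 bc dN c2.
set th := eps / 96; have th0 : 0 < th by rewrite divr_gt0.
have cR0 : 0 <= c%:R :> R by [].
have cR2 : c%:R <= 2 :> R by rewrite ler_nat.
pose lam := th * d * c%:R.
have lam0 : 0 <= lam by rewrite !mulr_ge0//; lra.
have := @bucket_moment R beta N lam (ltW b0) lam0.
under eq_bigr do rewrite /lam -[th * d * c%:R * _]mulrA.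
move=> M; apply: (le_trans M).
have {M} [c00|c_gt0] := posnP c.
  by rewrite /lam c00 !(mulr0, mul0r, expr0n, expR0, mul1r, mulr1, addr0).
have c1 : 1 <= c%:R :> R by rewrite ler1n.
have sp : 0 < Num.sqrt (2 * pi : R) by rewrite sqrtr_gt0 mulr_gt0// pi_gt0.
have peakE : normal_peak 1 = (Num.sqrt (2 * pi : R))^-1.
  by rewrite /normal_peak expr1n mul1r -mulr_natl.
have dbeta : d * beta <= (1 - eps) * Num.sqrt (2 * pi).
  have : d * beta <= d * ((1 - eps) * beta_c d) by rewrite ler_wpM2l//; lra.
  move=> h; apply: (le_trans h); rewrite /beta_c le_eqVlt; apply/orP; left; apply/eqP; field.
  by rewrite gt_eqF//; lra.
have db0 : 0 <= d * beta by rewrite mulr_ge0//; lra.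
(* The factor [sqrt (2 pi)] in [beta_c] cancels the peak of the Gaussian density. *)
have H1 : lam * beta * normal_peak 1 <= c%:R * th * (1 - eps).
  rewrite peakE ler_pdivrMr//; apply: (@le_trans _ _ (c%:R * th * (d * beta))).
    by rewrite /lam le_eqVlt; apply/orP; left; apply/eqP; ring.
  by rewrite -[leRHS]mulrA ler_wpM2l// mulr_ge0// ltW.
have H10 : 0 <= lam * beta * normal_peak 1.
  by rewrite mulr_ge0 ?normal_peak_ge0// mulr_ge0// ltW.
have H2 : lam / N.+1%:R <= 2 * th ^+ 2.
  rewrite ler_pdivrMr//; apply: (@le_trans _ _ (th * (th * N.+1%:R) * 2)).
    by rewrite /lam; apply: ler_pM => //; [rewrite mulr_ge0//; lra|rewrite ler_wpM2l// ltW].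
  by rewrite le_eqVlt; apply/orP; left; apply/eqP; ring.
have H3 : (lam * beta / 2) ^+ 2 / 2 <= 4 * th ^+ 2.
  have h : lam * beta / 2 <= th * Num.sqrt (2 * pi).
    have -> : lam * beta / 2 = th * (c%:R / 2) * (d * beta) by rewrite /lam; field.
    have : th * (c%:R / 2) <= th * 1 by apply: ler_wpM2l; [exact: ltW|lra].
    rewrite mulr1 => hc; apply: ler_pM => //; first by apply: mulr_ge0; lra.
    apply: (le_trans dbeta); rewrite -[leRHS]mul1r ler_wpM2r ?(ltW sp)//; lra.
  have : (lam * beta / 2) ^+ 2 <= (th * Num.sqrt (2 * pi)) ^+ 2.
    apply: lerXn2r => //; rewrite nnegrE.
      by rewrite divr_ge0// mulr_ge0// ltW.
    by rewrite mulr_ge0// ?(ltW th0) ?(ltW sp).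
  rewrite [(th * _) ^+ 2]exprMn sqr_sqrtr; last by rewrite mulr_ge0// pi_ge0.
  have : th ^+ 2 * (2 * pi) <= th ^+ 2 * 8.
    by rewrite ler_wpM2l ?sqr_ge0//; have := @pihalf_lt2 R; lra.
  lra.
have th1 : th <= 1 / 96 by rewrite /th; lra.
have H4 : expR (lam / N.+1%:R) * expR ((lam * beta / 2) ^+ 2 / 2) <= 1 + 12 * th ^+ 2.
  rewrite -expRD; apply: (@le_trans _ _ (expR (6 * th ^+ 2))).
    have -> : 6 * th ^+ 2 = 2 * th ^+ 2 + 4 * th ^+ 2 by ring.
    by rewrite ler_expR lerD.
  have : 6 * th ^+ 2 <= 2^-1 by nra.
  move=> h; have : 0 <= 6 * th ^+ 2 by rewrite mulr_ge0// sqr_ge0.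
  by move=> h0; apply: (le_trans (expR_le_1D2x h0 h)); lra.
rewrite mulrA.
apply: (@le_trans _ _ ((1 + 12 * th ^+ 2) * (1 + c%:R * th * (1 - eps)))).
  apply: ler_pM; [by rewrite mulr_ge0 ?expR_ge0| |exact: H4|by rewrite lerD2l].
  by rewrite addr_ge0.
have eE : eps = 96 * th by rewrite /th; lra.
have hu : c%:R * th * (1 - eps) <= 1.
  have : c%:R * th <= 2 * (1 / 96) by apply: ler_pM => //; lra.
  have : 0 <= c%:R * th by rewrite mulr_ge0// ltW.
  by move: (c%:R * th) => z; nra.
have : 12 * th ^+ 2 * (c%:R * th * (1 - eps)) <= 12 * th ^+ 2 * 1.
  by rewrite ler_wpM2l// mulr_ge0// sqr_ge0.
have : 1 * (24 * th ^+ 2) <= c%:R * (24 * th ^+ 2) by rewrite ler_wpM2r// mulr_ge0// sqr_ge0.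
move: (c%:R : R) => z; rewrite eE; move=> A B; clear -A B; lra.
Qed.

(** Here [t = d^(1/8)] and s is about [t ^+ 6]. The remaining slack between the threshold
    [1 - eps / 2] and the moment [1 - 3 * eps / 4] is [eps / 4], which makes the heavy term
    exponentially small in d. The required gain is of order [t ^+ 5 = d^(5/8)] in the exponent. *)
Lemma small_weight_bound (R : realType) (eps t : R) (s : nat) :
  0 < eps -> eps < 1 -> 111 <= eps / 4 * (eps / 96) * t ->
  s%:R <= t ^+ 6 -> t ^+ 6 - 1 <= s%:R ->
  (1 - eps / 4) ^+ s + (t ^+ 8) ^+ s * expR (- (eps / 96 * t ^+ 8 * (1 - eps / 2))) *
     expR (t ^+ 8 * (eps / 96 * (1 - 3 * eps / 4))) <=
  (3 + 3 * t ^+ 8)^-1 * ((12 * t ^+ 8 * expR (t ^+ 4 * (t + 1)))^-1) ^+ 4.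
Proof.
move=> e0 e1 tK st ts.
have c0 : 0 < eps / 4 * (eps / 96) by apply: mulr_gt0; lra.
have t0 : 0 < t by rewrite -(pmulr_rgt0 _ c0); apply: lt_le_trans tK; lra.
have et : 111 <= eps / 4 * t.
  apply: (le_trans tK); apply: ler_wpM2r; first exact: ltW.
  by apply: ler_piMr; lra.
have t1 : 1 <= t.
  have : eps / 4 * t <= 1 * t by apply: ler_wpM2r; [exact: ltW|lra].
  lra.
have X1 k : 1 <= t ^+ k by rewrite exprn_ege1.
have X0 k : 0 <= t ^+ k by exact: le_trans (X1 k).
have le_exp_t : t <= expR t by apply: le_trans (expR_ge1Dx t); rewrite lerDr.
have t15 : t <= t ^+ 5 by rewrite -[leLHS]expr1; exact: ler_weXn2l.
have t45 : t ^+ 4 <= t ^+ 5 by exact: ler_weXn2l.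
have t57 : t ^+ 5 <= t ^+ 7 by exact: ler_weXn2l.
(* From [s >= t ^+ 6 - 1] and [eps / 4 * t >= 111], the exponent is at least
   [111 * t ^+ 5 - eps / 4]. *)
have A : (1 - eps / 4) ^+ s <= expR (- (104 * t ^+ 5)).
  apply: (@le_trans _ _ (expR (s%:R * - (eps / 4)))).
    rewrite expRM_natl; apply: lerXn2r; rewrite ?nnegrE ?expR_ge0//; first lra.
    exact: expR_ge1Dx.
  rewrite ler_expR.
  have : (t ^+ 6 - 1) * (eps / 4) <= s%:R * (eps / 4) by apply: ler_wpM2r; lra.
  have : 111 * t ^+ 5 <= eps / 4 * t * t ^+ 5 by apply: ler_wpM2r.
  rewrite -[eps / 4 * t * _]mulrA -exprS; have := X1 5%N.
  move: (t ^+ 6) (t ^+ 5) => u v; clear -e1; lra.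
(* The slack gives at least [111 * t ^+ 7] in the exponent, and [(t ^+ 8) ^+ s <= expR (8 * t ^+ 7)]
   takes 8 of it; hence 103, and 111 = 103 + 8. *)
have B : (t ^+ 8) ^+ s * expR (- (eps / 96 * t ^+ 8 * (1 - eps / 2))) *
     expR (t ^+ 8 * (eps / 96 * (1 - 3 * eps / 4))) <= expR (- (103 * t ^+ 5)).
  apply: (@le_trans _ _ (expR (8 * t ^+ 7 - eps / 4 * (eps / 96) * t ^+ 8))).
    rewrite -mulrA -expRD.
    have -> : - (eps / 96 * t ^+ 8 * (1 - eps / 2)) + t ^+ 8 * (eps / 96 * (1 - 3 * eps / 4)) =
      - (eps / 4 * (eps / 96) * t ^+ 8) by field.
    rewrite [leRHS]expRD ler_wpM2r ?expR_ge0//.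
    rewrite -exprM; apply: (@le_trans _ _ (expR t ^+ (8 * s))).
      by apply: lerXn2r; rewrite ?nnegrE ?expR_ge0// ltW.
    rewrite -expRM_natl ler_expR natrM -mulrA; apply: ler_wpM2l; first exact: ler0n.
    by rewrite [t ^+ 7]exprSr ler_wpM2r// ltW.
  rewrite ler_expR [t ^+ 8]exprS mulrA.
  have : 111 * t ^+ 7 <= eps / 4 * (eps / 96) * t * t ^+ 7 by apply: ler_wpM2r.
  by move: (eps / 4 * _ * t * _) t57 => z; clear; lra.
(* Five factors bounded by [expR (11 + 8 * t)] and four by [expR (2 * t ^+ 5)] give the exponent
   [55 + 40 * t + 8 * t ^+ 5], at most [103 * t ^+ 5]. *)
have C : 2 * ((3 + 3 * t ^+ 8) * (12 * t ^+ 8 * expR (t ^+ 4 * (t + 1))) ^+ 4) <=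
    expR (103 * t ^+ 5).
  have h8 : t ^+ 8 <= expR (8 * t).
    by rewrite expRM_natl; apply: lerXn2r; rewrite ?nnegrE ?expR_ge0// ltW.
  have h12 : 12 <= expR 11 :> R by apply: le_trans (expR_ge1Dx _); lra.
  have W8 : 12 * t ^+ 8 <= expR 11 * expR (8 * t) by apply: ler_pM; rewrite ?ler0n.
  have W0 : 0 <= 12 * t ^+ 8 by apply: mulr_ge0; rewrite ?ler0n.
  have V0 := expR_ge0 (t ^+ 4 * (t + 1)).
  apply: (@le_trans _ _ ((expR 11 * expR (8 * t)) * (expR 11 * expR (8 * t) * expR (2 * t ^+ 5)) ^+ 4)).
    rewrite mulrA; apply: ler_pM.
    - by move: (X0 8%N); clear; lra.
    - by apply: exprn_ge0; exact: mulr_ge0.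
    - by apply: le_trans W8; move: (X1 8%N); clear; lra.
    - apply: lerXn2r; [by rewrite nnegrE mulr_ge0|by rewrite nnegrE !mulr_ge0 ?expR_ge0|].
      apply: ler_pM => //.
      by rewrite ler_expR mulrDr mulr1 -exprSr; move: t45; clear; lra.
  rewrite -!expRD -expRM_natl -expRD ler_expR; move: (X1 5%N) t15; clear; lra.
have D0 : 0 < 3 + 3 * t ^+ 8 by move: (X1 8%N); clear; lra.
have D1 : 0 < 12 * t ^+ 8 * expR (t ^+ 4 * (t + 1)).
  by rewrite !mulr_gt0 ?expR_gt0 ?exprn_gt0 ?ltr0n.
rewrite exprVn -invfM.
have D2 : 0 < (3 + 3 * t ^+ 8) * (12 * t ^+ 8 * expR (t ^+ 4 * (t + 1))) ^+ 4.
  by rewrite mulr_gt0// exprn_gt0.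
move: ((3 + 3 * t ^+ 8) * _) C D2 => W C D2.
apply: (@le_trans _ _ (2 * expR (- (103 * t ^+ 5)))).
  have : expR (- (104 * t ^+ 5)) <= expR (- (103 * t ^+ 5)).
    by rewrite ler_expR; move: (X0 5%N); clear; lra.
  move: A B; clear; lra.
rewrite expRN ler_pdivrMr ?expR_gt0// mulrC ler_pdivlMr//; exact: C.
Qed.

(** The constant 12 is 3 for a forced edge, times 2 for the choice of a branch, times 2 for a
    geometric series: consecutive terms have ratio [expR (- y) / 2], and the first factor alone
    yields [expR (- (y * r))]. *)
Lemma geometric_tail_le (R : realType) (d y r : R) (k : nat) :
  1 <= d -> 0 <= y ->
  \sum_(m < k | r <= m%:R) (3 * d) ^+ m * (2 * (12 * d * expR y)^-1) ^+ m.+1 <=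
  expR (- (y * r)).
Proof.
move=> d1 y0; have ey := expR_gt0 y; have ey1 : 1 <= expR y by rewrite -expR0 ler_expR.
set X := 2 * _.
have X0 : 0 <= X by rewrite mulr_ge0// invr_ge0 !mulr_ge0// ltW//; lra.
have Xh : X <= 2^-1.
  rewrite /X ler_pdivrMr; last by rewrite !mulr_gt0//; lra.
  have : 1 * 1 <= d * expR y by apply: ler_pM.
  by rewrite -[12 * d * _]mulrA; move: (d * expR y) => z; lra.
have XE : 3 * d * X = expR (- y) * 2^-1.
  by rewrite /X expRN; field; rewrite gt_eqF//= gt_eqF//; lra.
move: X X0 Xh XE => X X0 Xh XE.
apply: (@le_trans _ _ (\sum_(m < k) expR (- (y * r)) * (2^-1) ^+ m.+1)).
  rewrite big_mkcond; apply: ler_sum => m _; case: ifP => [rm|_]; last first.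
    by rewrite mulr_ge0 ?expR_ge0// exprn_ge0// invr_ge0.
  have -> : (3 * d) ^+ m * X ^+ m.+1 = expR (- y) ^+ m * 2^-1 ^+ m * X.
    by rewrite [X ^+ _]exprSr mulrA -[(3 * d) ^+ m * _]exprMn XE exprMn.
  rewrite [2^-1 ^+ m.+1]exprSr mulrA; apply: ler_pM => //.
  rewrite ler_wpM2r ?exprn_ge0 ?invr_ge0// -expRM_natl ler_expR mulrN lerN2.
  by rewrite [leRHS]mulrC ler_wpM2l.
rewrite -big_distrr /= -[leRHS]mulr1 ler_wpM2l ?expR_ge0//.
have -> : \sum_(m < k) 2^-1 ^+ m.+1 = 1 - 2^-1 ^+ k :> R.
  elim: k => [|k IH]; first by rewrite big_ord0 expr0 subrr.
  by rewrite big_ord_recr /= IH exprS; lra.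
by rewrite gerBl exprn_ge0// invr_ge0.
Qed.

(** * The first-moment bound for the bad event *)

Section BadEvent.
Variables (disp : measure_display) (T : measurableType disp) (R : realType).
Variables (P : probability T R) (n N k : nat).
Variables (X : {set 'I_n} -> {RV P >-> bool}) (J : {set 'I_n} -> {RV P >-> R}).
Variables (beta d eps r tau : R).
Hypotheses (e0 : 0 < eps) (e1 : eps < 1) (d0 : 0 <= d) (r0 : 0 <= r) (ktau : k%:R <= tau).

Local Notation a := ((1 - eps / 4) ^+ k).
Local Notation b := (d ^+ k * expR (- (tau * (1 - eps / 2)))).

Let a_ge0 : 0 <= a.
Proof. by apply: exprn_ge0; have := e0; have := e1; lra. Qed.

Let b_ge0 : 0 <= b.
Proof. by rewrite mulr_ge0 ?expR_ge0 ?exprn_ge0. Qed.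

Definition structure_sum (om : {ffun {set 'I_n} -> bool * 'I_N.+1}) : R :=
  \sum_(m < n | r <= m%:R) \sum_x \sum_(s : m.-tuple 'I_n) \sum_phi
    structure_weight (bucket_value R (N := N)) tau a b x s phi om.

Lemma structure_sum_ge0 om : 0 <= structure_sum om.
Proof.
do 4 (apply: sumr_ge0 => ? _); apply: structure_weight_ge0; first exact: a_ge0.
exact: b_ge0.
Qed.

(** A single term suffices, that of the structure from [bad_structure]: a product at least 1 stays
    so under the k-th power, and [vweight_pow_le] bounds each factor through the rounded
    influences. *)
Lemma structure_sum_ge1 w x p :
  locally_simple_paths (random_graph X w) r r (x, p) ->
  ~ (exists2 u, u \in x :: p &
       block_vertex (random_graph X w) (ea_influence J beta w) d eps u) ->
  1 <= structure_sum (discretize X J beta N w).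
Proof.
move=> ls nb.
have a0 := a_ge0; have b0 := b_ge0.
have SW0 := fun x s phi om => @structure_weight_ge0 R n N (bucket_value R (N := N)) tau a b a0 b0 x s phi om.
have [y [s [phi [rs adm sX W]]]] :=
  @bad_structure R n (fun e => X e w) (ea_influence J beta w) d eps r x p r0 ls nb.
set om := discretize _ _ _ _ _.
have sn : (size s < n)%N.
  case/and4P: (adm) => us _ _ _; rewrite -[ltnRHS](card_ord n) -[X in (X <= _)%N]/(size (y :: s)).
  by rewrite -(card_uniqP us); exact: max_card.
have omE (e : {set 'I_n}) : #|e| = 2%N -> om e = (X e w : bool, bucket beta N (J e w)).
  by move=> e2; rewrite ffunE e2.
apply: (@le_trans _ _ (structure_weight (bucket_value R (N := N)) tau a b y s phi om)); last first.
  rewrite /structure_sum (bigD1 (Ordinal sn))//= -[leLHS]addr0 lerD//; last first.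
    by do 4 (apply: sumr_ge0 => ? _).
  rewrite (bigD1 y)//= -[leLHS]addr0 lerD//; last by do 3 (apply: sumr_ge0 => ? _).
  rewrite (bigD1 (in_tuple s))//= -[leLHS]addr0 lerD//; last by do 2 (apply: sumr_ge0 => ? _).
  by rewrite (bigD1 phi)//= -[leLHS]addr0 lerD//; apply: sumr_ge0.
have F2 := admissible_card2 adm.
rewrite /structure_weight adm mul1r.
have -> : all (fun e => (om e).1) (edges (y :: s) ++ family_edges phi).
  apply/allP => e eF; move/allP: F2 => /(_ e eF) /eqP e2.
  by rewrite (omE e e2) /=; move/allP: sX; apply.
rewrite mul1r.
have Gam0 e : 0 <= ea_influence J beta w e by exact: influence_ge0.
have A0 v : 0 <= aggregate_influence (random_graph X w) (ea_influence J beta w) v.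
  by apply: sumr_ge0.
have v0 v : 0 <= vweight (random_graph X w) (ea_influence J beta w) d eps v.
  by rewrite /vweight; case: ifP => _; [have := e1; lra|rewrite mulr_ge0].
apply: (@le_trans _ _ ((\prod_(v <- family_vertices phi)
    vweight (random_graph X w) (ea_influence J beta w) d eps v) ^+ k)).
  exact: exprn_ege1.
rewrite -prodrXl; apply: ler_prod => v _; rewrite exprn_ge0//=.
apply: vweight_pow_le => //; apply: (@aggregate_influence_le R n (fun e => X e w)) => e e2.
by rewrite (omE e e2) /=; split => //; exact: influence_le_bucket.
Qed.

Variables (p h rho y : R).
Hypothesis EA : edwards_anderson X J p.
Hypotheses (p0 : 0 <= p) (p1 : p <= 1) (h0 : 0 <= h) (h1 : h <= 1) (np : 1 <= n%:R * p).
Hypothesis moment : forall c : nat, (c <= 2)%N ->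
  \sum_j bucket_prob beta j * expR (tau * (c%:R * bucket_value R (N := N) j)) <= 1 + c%:R * h.
Hypotheses (rho0 : 0 <= rho) (y0 : 0 <= y).
Hypothesis small_weight :
  a + b * expR (n%:R * p * h) <= rho * ((12 * (n%:R * p) * expR y)^-1) ^+ 4.
Hypothesis summable : rho * (3 + 3 * (n%:R * p)) <= 1.

Lemma prob_no_block_le :
  (P (~` [set w | forall x p,
        locally_simple_paths (random_graph X w) r r (x, p) ->
        exists2 u, u \in x :: p &
          block_vertex (random_graph X w) (ea_influence J beta w) d eps u]) <=
  (n%:R * expR (- (y * r)))%:E)%E.
Proof.
have mA := measurable_block_event X J beta d eps r.
have bad w : (~` [set w | forall x p,
        locally_simple_paths (random_graph X w) r r (x, p) ->
        exists2 u, u \in x :: p &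
          block_vertex (random_graph X w) (ea_influence J beta w) d eps u]) w ->
    1 <= structure_sum (discretize X J beta N w).
  move=> /existsNP[x /existsNP[q /not_implyP[ls nb]]]; exact: structure_sum_ge1 ls nb.
apply: (le_trans (prob_le_config_sum EA (measurableC mA) structure_sum_ge0 bad)).
have np12 : 1 <= 12 * (n%:R * p) * expR y.
  have : 1 <= expR y by rewrite -expR0 ler_expR.
  have := np; rewrite -mulrA; move: (n%:R * p) (expR y) => u v u1 v1.
  have : 1 * 1 <= u * v by apply: ler_pM.
  lra.
have np12_gt0 := lt_le_trans ltr01 np12.
have sig0 : 0 <= (12 * (n%:R * p) * expR y)^-1 by rewrite invr_ge0 ltW.
have sig1 : (12 * (n%:R * p) * expR y)^-1 <= 1 by rewrite invf_le1.
rewrite lee_fin.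
apply: le_trans (ler_wpM2l (ler0n _ _) (geometric_tail_le r n np y0)).
rewrite big_distrr /=.
under eq_bigr do rewrite /structure_sum big_distrr /=.
rewrite exchange_big; apply: ler_sum => i _.
rewrite [leRHS]mulrA.
apply: le_trans (expected_structure_sum p0 p1 (@bucket_prob_ge0 R beta N) h0 h1 moment
    a_ge0 b_ge0 rho0 sig0 sig1 small_weight summable i).
rewrite le_eqVlt; apply/orP; left; apply/eqP.
under eq_bigr do rewrite big_distrr /=.
rewrite exchange_big; apply: eq_bigr => x _.
under eq_bigr do rewrite big_distrr /=.
rewrite exchange_big; apply: eq_bigr => u _.
under eq_bigr do rewrite big_distrr /=.
by rewrite exchange_big.
Qed.

End BadEvent.

(** * The choice of the parameters *)

Theorem theorem9p1 (R : realType) (eps : R) (eps_gt0 : 0 < eps) :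
  exists d0 : R, 1 <= d0 /\
  forall d beta : R, d0 <= d -> 0 < beta -> beta <= (1 - eps) * beta_c d ->
  forall (n : nat) (disp : measure_display) (T : measurableType disp)
    (P : probability T R)
    (X : {set 'I_n} -> {RV P >-> bool}) (J : {set 'I_n} -> {RV P >-> R}),
  edwards_anderson X J (d / n%:R) ->
  let r : R := ln n%:R / Num.sqrt d in
  let l : R := r in
  ((1 - n%:R `^ (- (d `^ (1 / 8))))%:E <=
   P [set w | forall x p,
        locally_simple_paths (random_graph X w) r l (x, p) ->
        exists2 u, u \in x :: p &
          block_vertex (random_graph X w) (ea_influence J beta w) d eps u])%E.
Proof.
(* Since [t = d^(1/8) >= K], this secures the threshold 111 of [small_weight_bound]; the added 1
   gives [K >= 1]. *)
pose K : R := 111 / (eps / 4 * (eps / 96)) + 1.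
have c0 : 0 < eps / 4 * (eps / 96) by apply: mulr_gt0; lra.
have K1 : 1 <= K by rewrite lerDr divr_ge0 ?ler0n// ltW.
exists (K ^+ 8); split; first exact: exprn_ege1.
move=> d beta dK b0 bc n disp T P X J EA.
have d1 : 1 <= d by apply: le_trans dK; exact: exprn_ege1.
have d0 : 0 <= d by lra.
have eps_lt1 : eps < 1.
  rewrite ltNge; apply/negP => e1; have : beta <= 0.
    apply: (le_trans bc); rewrite mulr_le0_ge0//; first lra.
    by rewrite divr_ge0// sqrtr_ge0.
  lra.
cbv zeta; set r := ln _ / _; set A := [set w | _].
(* Without vertices there are no paths; for n = 1 the claimed lower bound is 0. *)
have [n1|n2] := leqP n 1.
  case: n n1 X J EA @r @A => [|[|//]] _ X J EA r A.
    have -> : A = setT by apply/seteqP; split => // w _ [].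
    by rewrite probability_setT lee_fin gerBl powR_ge0.
  by rewrite powR1 subrr measure_ge0.
have mA : measurable A by exact: measurable_block_event.
set t := d `^ (1 / 8).
have t0 : 0 <= t by exact: powR_ge0.
have t8 : t ^+ 8 = d.
  rewrite -powR_mulrn// /t -powRrM (_ : 1 / 8 * 8 = 1) ?powRr1//; by field.
have t_gt0 : 0 < t by rewrite powR_gt0//; lra.
have tK : K <= t.
  by rewrite -(@ler_pXn2r _ 8)// ?nnegrE ?t8//; lra.
have eK : 111 <= eps / 4 * (eps / 96) * t.
  have := ler_wpM2l (ltW c0) tK; apply: le_trans.
  rewrite /K mulrDr mulr1 [_ * (111 / _)]mulrCA divff ?gt_eqF// mulr1.
  by rewrite lerDl ltW.
have sqd : Num.sqrt d = t ^+ 4.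
  by rewrite -t8 (exprM t 4 2) sqrtr_sqr ger0_norm// exprn_ge0.
pose s := Num.truncn (t ^+ 6).
have st : s%:R <= t ^+ 6 by rewrite truncn_le exprn_ge0.
have ts : t ^+ 6 - 1 <= s%:R by have := truncnS_gt (t ^+ 6); rewrite -natr1 -/s; lra.
pose tau := eps / 96 * d; pose h := eps / 96 * (1 - 3 * eps / 4).
have stau : s%:R <= tau.
  apply: (le_trans st); rewrite /tau -t8 (exprD t 6 2) mulrCA ler_peMr ?exprn_ge0//.
  have et : eps / 4 * (eps / 96) * t <= eps / 96 * t.
    by apply: ler_wpM2r => //; apply: ler_piMl; lra.
  have : 1 * 1 <= eps / 96 * t * t by apply: ler_pM; lra.
  by rewrite mulr1 -mulrA -expr2.
(* The rounding is fine enough when [d / N.+1 <= eps / 96]. *)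
pose N := Num.truncn (d / (eps / 96)).
have dN : d <= eps / 96 * N.+1%:R.
  have th : 0 < eps / 96 by rewrite divr_gt0.
  by rewrite mulrC -ler_pdivrMr//; exact/ltW/truncnS_gt.
have n0 : 0 < n%:R :> R by rewrite ltr0n ltnW.
have np : n%:R * (d / n%:R) = d by rewrite mulrCA divff ?mulr1// gt_eqF.
have p0 : 0 <= d / n%:R by rewrite divr_ge0.
(* With two distinct vertices there is a pair, and [d / n] is the probability that it is an edge. *)
have p1 : d / n%:R <= 1.
  have [HX _ _] := EA.
  have c2 : #|[set Ordinal (ltnW n2); Ordinal n2]%SET| = 2%N by rewrite cards2.
  rewrite -lee_fin -(HX _ c2) probability_le1// -[X in measurable X]setTI.
  by apply: (@measurable_funPT _ _ _ _ (X _)).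
have h0 : 0 <= h by apply: mulr_ge0; lra.
have h1 : h <= 1 by rewrite /h; nra.
have r0 : 0 <= r by rewrite divr_ge0 ?sqrtr_ge0// ln_ge0// ler1n ltnW.
have y0 : 0 <= t ^+ 4 * (t + 1) by rewrite mulr_ge0 ?exprn_ge0 ?addr_ge0.
have np1 : 1 <= n%:R * (d / n%:R) by rewrite np.
have rhoP (z : R) : 1 <= z -> 0 <= (3 + 3 * z)^-1 /\ (3 + 3 * z)^-1 * (3 + 3 * z) <= 1.
  move=> z1; have z0 : 0 < 3 + 3 * z by lra.
  by rewrite invr_ge0 ltW// mulVf// gt_eqF.
have [rho0 summ] := rhoP _ np1.
have small := small_weight_bound eps_gt0 eps_lt1 eK st ts.
rewrite t8 -/h -/tau -{2 3 4}np in small.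
have PB : (P (~` A) <= (n%:R `^ (- t))%:E)%E.
  (* As [r = ln n / t ^+ 4], the choice [y = t ^+ 4 * (t + 1)] gives [y * r = (t + 1) * ln n]; the
     extra 1 absorbs the factor n for the first vertex of the spine. *)
  have -> : n%:R `^ (- t) = n%:R * expR (- (t ^+ 4 * (t + 1) * r)).
    rewrite /powR gt_eqF// -[in X in _ = X * _](lnK n0) -expRD; congr expR.
    rewrite /r sqd [t ^+ 4 * _ * _]mulrC mulrA divfK ?gt_eqF ?exprn_gt0//.
    by rewrite mulrDr mulr1 opprD addrCA subrr addr0 mulNr mulrC.
  apply: (prob_no_block_le (N := N) eps_gt0 eps_lt1 d0 r0 stau EA p0 p1 h0 h1 np1 _ rho0 y0
    small summ).
  by move=> c c2; exact: ea_edge_moment.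
have := probability_setC P (measurableC mA); rewrite setCK => ->.
by rewrite EFinB leeB.
Qed.
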